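(* Let $F:\Theta^*\to 2^Z\setminus\{\emptyset\}$. Then $F$ is mixed-Nash-A-implementable on the state space $\Theta_{\mathbb Q}=\{(\theta,u):\theta\in\Theta^*,u\in\Omega^{[\succeq^\theta,\mathbb Q]}\}$ if and only if it is mixed-Nash-A-implementable on $\Theta_{\mathbb R}=\{(\theta,u):\theta\in\Theta^*,u\in\Omega^{[\succeq^\theta,\mathbb R]}\}$, where in both cases the SCC assigns $F(\theta)$ to the state $(\theta,u)$. Explicitly: there is a mechanism $\mathcal M$ with $\bigcup_{\lambda\in MNE^{(\mathcal M,u)}}\mathrm{SUPP}(g[\lambda])=F(\theta)$ for all $\theta\in\Theta^*$, $u\in\Omega^{[\succeq^\theta,\mathbb Q]}$ iff there is a mechanism with this property for all $\theta\in\Theta^*$, $u\in\Omega^{[\succeq^\theta,\mathbb R]}$.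
   Context: Ordinal model: $\mathcal I=\{1,\dots,I\}$ finite with $I\ge3$; $Z$ finite; $Y=\Delta(Z)$; $\Theta^*$ is a finite set of ordinal states, each $\theta$ specifying complete preorders $(\succeq_i^\theta)_{i\in\mathcal I}$ on $Z$. For $\mathbb K\in\{\mathbb R,\mathbb Q\}$, $\Omega^{[\succeq^\theta,\mathbb K]}$ is the set of profiles $u=(u_i:Z\to\mathbb K)_i$ with $z\succeq_i^\theta z'\iff u_i(z)\ge u_i(z')$ for all $i,z,z'$. Under cardinal state $u$, agent $i$ evaluates $y\in Y$ by $\sum_zy_zu_i(z)$. A mechanism $\mathcal M=\langle M=\times_iM_i,g:M\to Y\rangle$ has countable $M_i$; $g(\lambda)$ is the lottery induced by a mixed profile $\lambda$; $MNE^{(\mathcal M,u)}$ is the set of mixed-strategy Nash equilibria under $u$. *)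

(* Defs.v *)
From HB Require Import structures.
From mathcomp Require Import all_boot all_order all_algebra.
From mathcomp Require Import all_classical all_reals.
From mathcomp Require Import ereal esum.
From mathcomp Require Import Rstruct.
From Stdlib Require Import Rdefinitions.

Set Implicit Arguments. Unset Strict Implicit. Unset Printing Implicit Defensive.
Import Order.TTheory GRing.Theory Num.Theory.
Local Open Scope classical_set_scope.
Local Open Scope ring_scope.

Record mechanism (I : nat) (Z : finType) := Mechanism {
  msg : 'I_I -> countType;
  outcome : {dffun forall i : 'I_I, msg i} -> Z -> R;
  outcome_lottery : forall m, (forall z, 0 <= outcome m z) /\ \sum_(z : Z) outcome m z = 1
}.
Arguments outcome {I Z} _ _ _.
Arguments msg {I Z} _ _.

Definition mixed_profile I Z (G : mechanism I Z) := forall i : 'I_I, msg G i -> R.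

Definition is_mixed_profile I Z (G : mechanism I Z) (lam : mixed_profile G) : Prop :=
  forall i, (forall m, 0 <= lam i m) /\ (\esum_(m in [set: msg G i]) (lam i m)%:E = 1)%E.

Definition induced_lottery I Z (G : mechanism I Z) (lam : mixed_profile G) (z : Z) : \bar R :=
  \esum_(m in [set: {dffun forall i : 'I_I, msg G i}])
     ((\prod_(i < I) lam i (m i)) * outcome G m z)%:E.

Definition exp_util I Z (G : mechanism I Z) (u : 'I_I -> Z -> R)
    (lam : mixed_profile G) (i : 'I_I) : R :=
  \sum_(z : Z) fine (induced_lottery lam z) * u i z.

Definition MNE I Z (G : mechanism I Z) (u : 'I_I -> Z -> R) (lam : mixed_profile G) : Prop :=
  is_mixed_profile lam /\
  forall (i : 'I_I) (lam' : mixed_profile G), is_mixed_profile lam' ->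
    (forall j, j != i -> lam' j = lam j) ->
    exp_util u lam' i <= exp_util u lam i.

Definition represents (T : numDomainType) I (Z : finType) (Theta : Type)
    (pref : Theta -> 'I_I -> rel Z) (th : Theta) (u : 'I_I -> Z -> T) : Prop :=
  forall i z z', pref th i z z' = (u i z' <= u i z).

Definition implements_at I Z (G : mechanism I Z) (u : 'I_I -> Z -> R) (S : {set Z}) : Prop :=
  forall z, z \in S <-> exists lam : mixed_profile G, MNE u lam /\ (0 < induced_lottery lam z)%E.

Definition mixed_Nash_implementable_Q I (Z Theta : finType)
    (pref : Theta -> 'I_I -> rel Z) (F : Theta -> {set Z}) : Prop :=
  exists G : mechanism I Z, forall (th : Theta) (u : 'I_I -> Z -> rat),
    represents pref th u -> implements_at G (fun i z => ratr (u i z)) (F th).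

Definition mixed_Nash_implementable_R I (Z Theta : finType)
    (pref : Theta -> 'I_I -> rel Z) (F : Theta -> {set Z}) : Prop :=
  exists G : mechanism I Z, forall (th : Theta) (u : 'I_I -> Z -> R),
    represents pref th u -> implements_at G u (F th).

(* Main.v *)
Require Import Defs.
From mathcomp Require Import all_boot all_order all_algebra.

(** From a mechanism implementing [F] on the rational cardinalizations one reads
    off, for every agent [i] and ordinal state [th], the set [D i th] of outcomes
    that [i] can reach by deviating from an equilibrium at [th]. These sets satisfy
    purely ordinal conditions ([blocking_sets]). For the monotonicity condition,
    when [th'] refines what [th] says about [F th] inside [D i th], a utility at
    [th] can be lowered outside [F th] to a rational utility for [th'], so that the
    equilibrium survives at [th'].

    Conversely, the ordinal conditions suffice for implementation on the real
    cardinalizations, by a canonical mechanism. When all agents announce [th], the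
    outcome is uniform on [F th]. A lone dissenter picks, from a finite menu, a
    lottery on [D i th] perturbed towards one of full support; otherwise an integer
    game is played. The announcements also carry an integer [n], along which the
    menus shrink: each menu item is unprofitable at [th] for every utility
    once [n] is large, which is how countably many messages cope with uncountably
    many utilities. *)

Module CanonicalMechanism.
From mathcomp Require Import finmap all_classical all_reals.
From mathcomp Require Import ereal esum Rstruct ring lra.
Import Order.TTheory GRing.Theory Num.Theory.
Set Implicit Arguments. Unset Strict Implicit. Unset Printing Implicit Defensive.
Local Open Scope classical_set_scope.
Local Open Scope ring_scope.
Local Notation R := Rdefinitions.R.

(** * Countable sums and products of discrete distributions *)

Section Esum.
Variable K : realType.

Lemma esumZl (T : choiceType) (S : set T) (c : K) (a : T -> \bar K) :
  0 <= c -> (forall i, 0 <= a i)%E ->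
  (\esum_(i in S) (c%:E * a i) = c%:E * \esum_(i in S) a i)%E.
Proof.
move=> c0 a0; rewrite /esum -ereal_supZl//; last first.
  apply/set0P; exists (\sum_(x \in set0) a x)%E; exists set0 => //.
  exact: fsets_set0.
congr ereal_sup; rewrite image_comp; apply: eq_imagel => A _ /=.
by rewrite ge0_mule_fsumr.
Qed.

Lemma esum_ge_term (T : choiceType) (a : T -> \bar K) t :
  (forall i, 0 <= a i)%E -> (a t <= \esum_(i in [set: T]) a i)%E.
Proof.
move=> a0; rewrite -(esum_set1 (a0 t)) [leRHS](esumID [set t])// setTI.
by rewrite leeDl// esum_ge0.
Qed.

Lemma esum_fiber (T1 T2 : choiceType) (t : T1 -> T2) (a : T1 -> \bar K) :
  (forall i, 0 <= a i)%E ->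
  (\esum_(b in [set: T2]) \esum_(i in [set i | t i = b]) a i =
   \esum_(i in [set: T1]) a i)%E.
Proof.
move=> a0; rewrite esum_esum// [LHS](reindex_esum [set: T1] _ (fun i => (t i, i)))//.
split.
- by [].
- by move=> i j _ _ [].
- by move=> [b i] /= [_ <-]; exists i.
Qed.

(** A form of Fatou's lemma. A finite partial sum involves finitely many [m], so one [n] serves them
    all, and the total error is at most [e] because [p] has mass 1. *)
Lemma esum_fatou (T : choiceType) (p w : T -> K) (v : nat -> T -> K) (c : \bar K) :
  (forall m, 0 <= p m) -> (\esum_(m in [set: T]) (p m)%:E = 1)%E ->
  (forall n m, 0 <= v n m) ->
  (forall m e, 0 < e -> exists n0, forall n, (n0 <= n)%N -> w m - e <= v n m) ->
  (forall n, \esum_(m in [set: T]) (p m * v n m)%:E <= c)%E ->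
  (\esum_(m in [set: T]) (p m * w m)%:E <= c)%E.
Proof.
move=> p0 p1 v0 lim vc; apply: ge_ereal_sup => _ [A [finA _] <-].
apply/lee_addgt0Pr => e e0.
have [n Hn] : exists n, forall m, A m -> w m - e <= v n m.
  have /choice[n0 Hn0] : forall m, exists n0, forall n, (n0 <= n)%N -> w m - e <= v n m.
    by move=> m; exact: lim.
  exists (\max_(m <- fset_set A) n0 m)%N => m Am; apply: Hn0.
  by apply: leq_bigmax_seq => //; rewrite in_fset_set// mem_set.
have pA : (\sum_(m \in A) (p m)%:E <= 1)%E.
  by rewrite -p1; apply: esum_ge; exists A.
apply: (@le_trans _ _ (\sum_(m \in A) (p m * v n m)%:E + \sum_(m \in A) (e * p m)%:E)%E).
  rewrite -fsbig_split//; apply: lee_fsum => // m Am /=.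
  rewrite -EFinD lee_fin [e * _]mulrC -mulrDr ler_wpM2l//.
  by rewrite -lerBlDr Hn.
apply: leeD.
  apply: (le_trans _ (vc n)); apply: esum_ge; exists A => //.
under eq_fsbigr do rewrite EFinM.
rewrite -ge0_mule_fsumr; last by move=> m; rewrite lee_fin.
by rewrite -[leRHS]mule1 lee_wpmul2l// lee_fin ltW.
Qed.

(** The nonnegative terms [p m * (g m - f m)] have sum zero, so each vanishes; finiteness of the sum
    for [f] permits the cancellation. *)
Lemma esum_le_eq (T : choiceType) (p f g : T -> K) :
  (forall m, 0 <= p m) -> (forall m, 0 <= f m) -> (forall m, f m <= g m) ->
  (\esum_(m in [set: T]) (p m * f m)%:E < +oo)%E ->
  (\esum_(m in [set: T]) (p m * g m)%:E <= \esum_(m in [set: T]) (p m * f m)%:E)%E ->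
  forall m, 0 < p m -> f m = g m.
Proof.
move=> p0 f0 fg fin gf m pm.
have d0 x : 0 <= p x * (g x - f x) by rewrite mulr_ge0// subr_ge0.
have pf0 x : 0 <= p x * f x by rewrite mulr_ge0.
have E : (\esum_(m in [set: T]) (p m * g m)%:E =
  \esum_(m in [set: T]) (p m * f m)%:E + \esum_(m in [set: T]) (p m * (g m - f m))%:E)%E.
  rewrite -esumD; try by move=> x _; rewrite lee_fin.
  by apply: eq_esum => x _; rewrite -EFinD -mulrDr addrCA subrr addr0.
have finf : (\esum_(m in [set: T]) (p m * f m)%:E)%E \is a fin_num.
  by rewrite ge0_fin_numE// esum_ge0// => x _; rewrite lee_fin.
move: gf; rewrite E -[leRHS]adde0 leeD2lE// => d.
have : ((p m * (g m - f m))%:E <= 0)%E.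
  by apply: le_trans d; apply: (esum_ge_term (a := fun x => (p x * (g x - f x))%:E)).
rewrite lee_fin pmulr_rle0// subr_le0 => gf.
by apply/eqP; rewrite eq_le fg gf.
Qed.

End Esum.

(** * Product distributions and deviations in one coordinate *)

Section ProductMeasure.
Variables (K : realType) (n : nat) (T : 'I_n -> countType).
Local Notation prof := {dffun forall i, T i}.

Definition upd (m : prof) i (a : T i) : prof :=
  [ffun j => eqtype.dfwith (fun k => m k) a j].

Lemma upd_in m i (a : T i) : upd m a i = a.
Proof. by rewrite ffunE eqtype.dfwith_in. Qed.

Lemma upd_out m i (a : T i) j : j != i -> upd m a j = m j.
Proof. by move=> ji; rewrite ffunE eqtype.dfwith_out// eq_sym. Qed.

Lemma updK m i (a b : T i) : upd (upd m a) b = upd m b.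
Proof.
apply/ffunP => j; have [->|ji] := eqVneq j i; first by rewrite !upd_in.
by rewrite !upd_out.
Qed.

Lemma upd_id (m : prof) i : upd m (m i) = m.
Proof.
apply/ffunP => j; have [->|ji] := eqVneq j i; first by rewrite !upd_in.
by rewrite !upd_out.
Qed.

Variable lam : forall i, T i -> K.
Arguments lam : clear implicits.
Hypothesis lam0 : forall i a, 0 <= lam i a.
Hypothesis lam1 : forall i, (\esum_(a in [set: T i]) (lam i a)%:E = 1)%E.

(** Fubini, by induction on the list of coordinates being summed. *)
Lemma prod_mass : (\esum_(m in [set: prof]) (\prod_i lam i (m i))%:E = 1)%E.
Proof.
(* A sum over an empty type is not 1, so every [T i] is inhabited and a base profile exists. *)
have [m0] : exists m0 : prof, True.
  have a0 i : T i.
    apply: (projT1 (cid (_ : exists _ : T i, True))); apply: contrapT => nT.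
    have := lam1 i; rewrite esum1 => [/eqP|a _]; first by rewrite eq_sym onee_eq0.
    by case: nT; exists a.
  by exists [ffun i => a0 i].
move=> _.
suff H (s : seq 'I_n) : uniq s -> forall m0 : prof,
    (\esum_(m in [set m : prof | forall j, j \notin s -> m j = m0 j])
       (\prod_(i <- s) lam i (m i))%:E = 1)%E.
  have := H (index_enum 'I_n) (index_enum_uniq _) m0.
  rewrite (_ : [set _ | _] = setT)//; apply/seteqP; split => // m _ j /=.
  by rewrite mem_index_enum.
elim: s => [_ {}m0|i s IH /= /andP[ins us] {}m0].
  rewrite (_ : [set _ | _] = [set m0]).
    by rewrite esum_set1 big_nil ?lee_fin.
  apply/seteqP; split => [m /= H|m -> //]; apply/ffunP => j; exact: H.
have prod0 r (m : prof) : 0 <= \prod_(j <- r) lam j (m j) by rewrite prodr_ge0.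
rewrite [LHS](@reindex_esum _ _ _
  ([set: T i] `*`` fun a => [set m : prof | forall j, j \notin s -> m j = upd m0 a j])
  _ (fun k : T i * prof => k.2)).
- rewrite -(esum_esum (a := fun a (m : prof) => (\prod_(j <- i :: s) lam j (m j))%:E));
    last by move=> a m _ _; rewrite lee_fin.
  rewrite -[RHS](lam1 i); apply: eq_esum => a _.
  rewrite -[RHS]mule1 -(IH us (upd m0 a)) -esumZl//; last first.
    by move=> m; rewrite lee_fin.
  apply: eq_esum => m Hm; rewrite big_cons EFinM.
  by rewrite (Hm i ins) upd_in.
- split.
  + move=> [a m] /= [_ H] j; rewrite inE negb_or => /andP[ji js].
    by rewrite H// upd_out.
  + move=> [a m] [b m']; rewrite !inE /= => -[_ Ha] [_ Hb] mm'.
    by rewrite mm' in Ha *; rewrite -(upd_in m0 a) -(upd_in m0 b) -Ha// -Hb.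
  + move=> m /= H; exists (m i, m) => //; split => // j js.
    have [->|ji] := eqVneq j i; first by rewrite upd_in.
    by rewrite upd_out// H// inE negb_or ji.
Qed.

Variables (i : 'I_n) (t : T i -> T i).

(** The pushforward of [lam i] under [t]: agent [i] draws a message as before and sends its
    image. *)
Definition push : forall j, T j -> K :=
  eqtype.dfwith lam (fun b => fine (\esum_(a in [set a | t a = b]) (lam i a)%:E)%E).

Arguments push : clear implicits.

Lemma push_out j : j != i -> push j = lam j.
Proof. by move=> ji; rewrite /push eqtype.dfwith_out// eq_sym. Qed.

Lemma push_in b : (push i b)%:E = (\esum_(a in [set a | t a = b]) (lam i a)%:E)%E.
Proof.
rewrite /push eqtype.dfwith_in fineK// ge0_fin_numE ?esum_ge0// => [|x _]; last by rewrite lee_fin.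
apply: (@le_lt_trans _ _ 1%E); rewrite ?ltry// -(lam1 i).
rewrite [leRHS](esumID [set a | t a = b]) => [|x _]; last by rewrite lee_fin.
by rewrite setTI leeDl// esum_ge0// => x _; rewrite lee_fin.
Qed.

Lemma push_ge0 j b : 0 <= push j b.
Proof.
have [ji|ji] := eqVneq j i; last by rewrite push_out.
subst j; rewrite -lee_fin push_in esum_ge0// => x _; by rewrite lee_fin.
Qed.

Lemma push_mass j : (\esum_(a in [set: T j]) (push j a)%:E = 1)%E.
Proof.
have [ji|ji] := eqVneq j i; last by rewrite push_out.
subst j; under eq_esum do rewrite push_in.
by rewrite esum_fiber// => x; rewrite lee_fin.
Qed.

Lemma prod_upd (l : forall j, T j -> K) (m : prof) (a : T i) :
  \prod_j l j (upd m a j) = l i a * \prod_(j | j != i) l j (m j).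
Proof.
rewrite (bigD1 i)//= upd_in; congr *%R; apply: eq_bigr => j ji.
by rewrite upd_out.
Qed.

Lemma esum_push (f : prof -> K) : (forall m, 0 <= f m) ->
  (\esum_(m in [set: prof]) ((\prod_j push j (m j)) * f m)%:E =
   \esum_(m in [set: prof]) ((\prod_j lam j (m j)) * f (upd m (t (m i))))%:E)%E.
Proof.
move=> f0.
have q0 (m : prof) : 0 <= \prod_(j | j != i) lam j (m j) by rewrite prodr_ge0.
(* The index is a played profile [m] together with a drawn message [a] such that [t a = m i]; the
   drawn profile is [upd m a]. *)
rewrite [RHS](@reindex_esum _ _ _
  ([set: prof] `*`` fun m => [set a | t a = m i]) _
  (fun k : prof * T i => upd k.1 k.2)); last first.
  split => //.
  + move=> [m a] [m' a']; rewrite !inE /= => -[_ Ha] [_ Hb] mm'.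
    have aa' : a = a' by rewrite -(upd_in m a) -(upd_in m' a') mm'.
    subst a'; congr pair; apply/ffunP => j.
    have [->|ji] := eqVneq j i; first by rewrite -Ha -Hb.
    by rewrite -(upd_out m a ji) mm' upd_out.
  + move=> m _; exists (upd m (t (m i)), m i); last by rewrite /= updK upd_id.
    by split => //=; rewrite upd_in.
transitivity (\esum_(m in [set: prof]) \esum_(a in [set a | t a = m i])
  ((\prod_j lam j (upd m a j)) * f (upd (upd m a) (t (upd m a i))))%:E)%E; last first.
  rewrite (esum_esum (a := fun m a => ((\prod_j lam j (upd m a j)) *
    f (upd (upd m a) (t (upd m a i))))%:E))// => m a _ _.
  by rewrite lee_fin mulr_ge0// prodr_ge0.
apply: eq_esum => m _.
transitivity (\esum_(a in [set a | t a = m i])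
  (((\prod_(j | j != i) lam j (m j)) * f m)%:E * (lam i a)%:E))%E; last first.
  apply: eq_esum => a /= ta; rewrite upd_in ta updK upd_id prod_upd.
  by rewrite -EFinM mulrC mulrA.
rewrite esumZl; [|by rewrite mulr_ge0|by move=> a; rewrite lee_fin].
rewrite -push_in -{1}(upd_id m i) prod_upd -EFinM; congr EFin.
under eq_bigr => j ji do rewrite push_out//.
by rewrite mulrAC -mulrA mulrC [f m * _]mulrC.
Qed.

End ProductMeasure.

(** * Mixed strategies *)

Section Mechanism.
Variables (I : nat) (Z : finType) (G : mechanism I Z).
Implicit Types (lam : mixed_profile G) (u : 'I_I -> Z -> R).
Local Notation prof := {dffun forall i, msg G i}.

Definition prob lam (m : prof) : R := \prod_i lam i (m i).

Definition payoff u i (m : prof) : R := \sum_z outcome G m z * u i z.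

Lemma outcome_ge0 m z : 0 <= outcome G m z.
Proof. exact: (outcome_lottery m).1. Qed.

Lemma outcome_sum1 m : \sum_z outcome G m z = 1.
Proof. exact: (outcome_lottery m).2. Qed.

Lemma prob_ge0 lam m : is_mixed_profile lam -> 0 <= prob lam m.
Proof. by move=> H; rewrite prodr_ge0// => i _; exact: (H i).1. Qed.

Lemma prob_mass lam : is_mixed_profile lam ->
  (\esum_(m in [set: prof]) (prob lam m)%:E = 1)%E.
Proof.
by move=> H; apply: prod_mass => i; [exact: (H i).1|exact: (H i).2].
Qed.

Lemma lottery_ge0 lam z : is_mixed_profile lam -> (0 <= induced_lottery lam z)%E.
Proof.
move=> H; apply: esum_ge0 => m _; rewrite lee_fin mulr_ge0 ?outcome_ge0//.
exact: prob_ge0.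
Qed.

Lemma lottery_sum lam : is_mixed_profile lam -> (\sum_z induced_lottery lam z = 1)%E.
Proof.
move=> H; rewrite /induced_lottery -esum_sum; last first.
  by move=> m z _ _; rewrite lee_fin mulr_ge0 ?outcome_ge0// (prob_ge0 m H).
rewrite -[RHS](prob_mass H); apply: eq_esum => m _.
by rewrite sumEFin -mulr_sumr outcome_sum1 mulr1.
Qed.

Lemma lottery_fin lam z : is_mixed_profile lam -> induced_lottery lam z \is a fin_num.
Proof.
move=> H; rewrite ge0_fin_numE ?lottery_ge0//.
apply: (@le_lt_trans _ _ 1%E); rewrite ?ltry// -(lottery_sum H) (bigD1 z)//= leeDl//.
by apply: sume_ge0 => *; exact: lottery_ge0.
Qed.

Lemma fine_lottery_ge0 lam z : is_mixed_profile lam -> 0 <= fine (induced_lottery lam z).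
Proof. by move=> H; rewrite fine_ge0// lottery_ge0. Qed.

Lemma fine_lottery_sum lam : is_mixed_profile lam ->
  \sum_z fine (induced_lottery lam z) = 1.
Proof.
move=> H; apply: EFin_inj; rewrite -sumEFin -[RHS](lottery_sum H).
by apply: eq_bigr => z _; rewrite fineK// lottery_fin.
Qed.

Lemma fine_lottery_eq0 lam z : is_mixed_profile lam ->
  ~ (0 < induced_lottery lam z)%E -> fine (induced_lottery lam z) = 0.
Proof.
move=> H /negP; rewrite -leNgt => le0.
by rewrite (_ : induced_lottery _ _ = 0%E)//; apply/eqP; rewrite eq_le le0 lottery_ge0.
Qed.

Lemma lottery_gt0P lam z : is_mixed_profile lam -> (0 < induced_lottery lam z)%E ->
  exists2 m, 0 < prob lam m & 0 < outcome G m z.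
Proof.
move=> H; apply: contraPP => nex; apply/negP; rewrite -leNgt.
rewrite [X in (X <= _)%E]esum1// => m _; congr EFin; apply/eqP; rewrite mulf_eq0.
apply: contraPT nex; rewrite negb_or => /andP[p0 o0]; apply; exists m.
  by rewrite lt0r prob_ge0// p0.
by rewrite lt0r outcome_ge0 o0.
Qed.

Lemma lottery_gt0 lam m z : is_mixed_profile lam ->
  0 < prob lam m -> 0 < outcome G m z -> (0 < induced_lottery lam z)%E.
Proof.
move=> H p0 o0; apply: (@lt_le_trans _ _ (prob lam m * outcome G m z)%:E).
  by rewrite lte_fin mulr_gt0.
apply: (esum_ge_term (a := fun m => (prob lam m * outcome G m z)%:E)) => x.
by rewrite lee_fin mulr_ge0 ?outcome_ge0// prob_ge0.
Qed.

Lemma payoff_ge0 u i m : (forall z, 0 <= u i z) -> 0 <= payoff u i m.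
Proof. by move=> u0; apply: sumr_ge0 => z _; rewrite mulr_ge0 ?outcome_ge0. Qed.

Lemma exp_utilE u lam i : is_mixed_profile lam -> (forall z, 0 <= u i z) ->
  ((exp_util u lam i)%:E = \esum_(m in [set: prof]) (prob lam m * payoff u i m)%:E)%E.
Proof.
move=> H u0; rewrite /exp_util -sumEFin.
under [RHS]eq_esum do rewrite /payoff mulr_sumr -sumEFin.
rewrite esum_sum; last first.
  by move=> m z _ _; rewrite lee_fin !mulr_ge0 ?outcome_ge0 ?prob_ge0.
apply: eq_bigr => z _; rewrite EFinM fineK ?lottery_fin// muleC -esumZl//; last first.
  by move=> m; rewrite lee_fin mulr_ge0 ?outcome_ge0// (prob_ge0 m H).
by apply: eq_esum => m _; rewrite -EFinM mulrA mulrC.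
Qed.

Lemma exp_util_shift u c lam i : is_mixed_profile lam ->
  exp_util (fun i z => u i z + c) lam i = exp_util u lam i + c.
Proof.
move=> H; rewrite /exp_util; under eq_bigr do rewrite mulrDr.
by rewrite big_split/= -mulr_suml fine_lottery_sum// mul1r.
Qed.

(** Induced lotteries have mass 1, so all expected utilities move by [c]. Utilities can thus be made
    nonnegative, as the countable sums require. *)
Lemma MNE_shift u c lam : MNE u lam -> MNE (fun i z => u i z + c) lam.
Proof.
move=> [H opt]; split => // i lam' H' eq'.
by rewrite !exp_util_shift// lerD2r opt.
Qed.

(** The deviation is [push lam t]. By [esum_push] both sides are sums against the same weights, so
    that they can be compared profile by profile. *)
Lemma MNE_deviation u lam i (t : msg G i -> msg G i) :
  MNE u lam -> (forall z, 0 <= u i z) ->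
  (\esum_(m in [set: prof]) (prob lam m * payoff u i (upd m (t (m i))))%:E <=
   \esum_(m in [set: prof]) (prob lam m * payoff u i m)%:E)%E.
Proof.
move=> [H opt] u0.
have lam0 j a : 0 <= lam j a by exact: (H j).1.
have lam1 j : (\esum_(a in [set: msg G j]) (lam j a)%:E = 1)%E by exact: (H j).2.
pose lam' : mixed_profile G := push lam t.
have H' : is_mixed_profile lam'.
  by move=> j; split; [move=> a; exact: push_ge0|exact: push_mass].
have := opt i lam' H'; rewrite -lee_fin !exp_utilE//.
rewrite /prob esum_push//; last by move=> m; exact: payoff_ge0.
by apply => j ji; exact: push_out.
Qed.

Lemma exp_util_le u lam i c : is_mixed_profile lam ->
  (forall z, (0 < induced_lottery lam z)%E -> u i z <= c) -> exp_util u lam i <= c.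
Proof.
move=> H uc; rewrite -[c]mul1r -(fine_lottery_sum H) mulr_suml.
apply: ler_sum => z _; have [L0|L0] := pselect (0 < induced_lottery lam z)%E.
  by rewrite ler_wpM2l ?fine_lottery_ge0// uc.
by rewrite fine_lottery_eq0// !mul0r.
Qed.

Lemma exp_util_ge u lam i c : is_mixed_profile lam ->
  (forall z, (0 < induced_lottery lam z)%E -> c <= u i z) -> c <= exp_util u lam i.
Proof.
move=> H uc; rewrite -[c]mul1r -(fine_lottery_sum H) mulr_suml.
apply: ler_sum => z _; have [L0|L0] := pselect (0 < induced_lottery lam z)%E.
  by rewrite ler_wpM2l ?fine_lottery_ge0// uc.
by rewrite fine_lottery_eq0// !mul0r.
Qed.

Lemma exp_util_lt u lam i c z : is_mixed_profile lam ->
  (forall z, (0 < induced_lottery lam z)%E -> c <= u i z) ->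
  (0 < induced_lottery lam z)%E -> c < u i z -> c < exp_util u lam i.
Proof.
move=> H uc Lz cz; rewrite -[c]mul1r -(fine_lottery_sum H) mulr_suml.
rewrite /exp_util (bigD1 z)//= [ltRHS](bigD1 z)//=; apply: ltr_leD.
  by rewrite ltr_pM2l// fine_gt0// Lz ltey_eq lottery_fin.
apply: ler_sum => x _; have [L0|L0] := pselect (0 < induced_lottery lam x)%E.
  by rewrite ler_wpM2l ?fine_lottery_ge0// uc.
by rewrite fine_lottery_eq0// !mul0r.
Qed.

Lemma exp_util_le_payoff u lam i c : is_mixed_profile lam -> (forall z, 0 <= u i z) ->
  (forall m, 0 < prob lam m -> payoff u i m <= c) -> exp_util u lam i <= c.
Proof.
move=> H u0 uc.
(* A profile of positive probability shows that [c] is nonnegative, as [esumZl] requires. *)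
rewrite -lee_fin exp_utilE//; have [m pm] : exists m, 0 < prob lam m.
  apply: contrapT => nm; have := prob_mass H; rewrite esum1 => [/eqP|m _].
    by rewrite eq_sym onee_eq0.
  congr EFin; apply/eqP; rewrite eq_le prob_ge0// andbT leNgt; apply/negP => pm.
  by apply: nm; exists m.
have cge0 : 0 <= c by apply: le_trans (uc m pm); exact: payoff_ge0.
rewrite -[c%:E]mule1 -(prob_mass H) -esumZl//; last by move=> x; rewrite lee_fin prob_ge0.
apply: le_esum => x _; rewrite -EFinM lee_fin mulrC.
have := prob_ge0 x H; rewrite le_eqVlt => /orP[/eqP <-|px]; first by rewrite !mulr0.
by rewrite ler_wpM2r ?uc// ltW.
Qed.

Lemma exp_util_ge_payoff u lam i c : is_mixed_profile lam -> (forall z, 0 <= u i z) ->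
  0 <= c -> (forall m, 0 < prob lam m -> c <= payoff u i m) -> c <= exp_util u lam i.
Proof.
move=> H u0 c0 uc; rewrite -lee_fin exp_utilE//.
rewrite -[c%:E]mule1 -(prob_mass H) -esumZl//; last by move=> x; rewrite lee_fin prob_ge0.
apply: le_esum => x _; rewrite -EFinM lee_fin [leRHS]mulrC.
have := prob_ge0 x H; rewrite le_eqVlt => /orP[/eqP <-|px]; first by rewrite !mulr0.
by rewrite ler_wpM2r ?uc// ltW.
Qed.

End Mechanism.

(** * Ordinal conditions necessary for implementation *)

Section Preorder.
Variable Z : finType.
Implicit Types (r : rel Z) (A B : {set Z}).

(** For a total [r] this counts the outcomes strictly worse than [z], which gives an integer
    utility. *)
Definition rank r z : nat := #|[pred z' | ~~ r z' z]|.

Lemma rankP r z z' : total r -> transitive r -> r z z' = (rank r z' <= rank r z)%N.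
Proof.
move=> tot tr; apply/idP/idP => [zz'|].
  apply/subset_leq_card/fintype.subsetP => y; rewrite !inE; apply: contra => yz.
  exact: tr yz zz'.
apply: contraTT => nzz'; rewrite -ltnNge; apply: proper_card.
have z'z : r z' z by have := tot z z'; rewrite (negbTE nzz').
apply/fintype.properP; split.
  by apply/fintype.subsetP => y; rewrite !inE; apply: contra => yz'; exact: tr yz' z'z.
exists z; rewrite !inE// negbK; by have := tot z z; rewrite orbb.
Qed.

Definition dominates r A B := forall x z, x \in A -> z \in B -> r x z.

(** For total preorders: within [B], the weak and the strict lower contour sets of each [x] in [A]
    at [r] are contained in those at [r']. *)
Definition nested r r' A B := forall x z, x \in A -> z \in B ->
  (r x z -> r' x z) /\ (r' z x -> r z x).

(** The value of [z] is the largest [u x] over the [x] in [A] weakly below [z] at [r'], corrected by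
    a small multiple of the rank to make strict preferences strict. *)
Lemma nested_utility (K : realFieldType) r r' A B (u : Z -> K) :
  total r' -> transitive r' -> A \subset B -> nested r r' A B ->
  (forall z z', r z z' = (u z' <= u z)) ->
  exists u' : Z -> K, [/\ forall z z', r' z z' = (u' z' <= u' z),
    forall x, x \in A -> u' x = u x & forall z, z \in B -> u' z <= u z].
Proof.
move=> tot tr AB nest ru.
(* The scale [tau] is so small that rank corrections never exceed a positive gap of [u]. *)
have [tau [tau0 gap]] : exists tau : K, 0 < tau /\
    forall x z, u x < u z -> tau * #|Z|%:R <= u z - u x.
  pose g (p : Z * Z) := u p.2 - u p.1.
  pose t := \big[Num.min/1]_(p : Z * Z | u p.1 < u p.2) g p.
  have t0 : 0 < t.
    rewrite /t; elim/big_ind: _ => [|x y x0 y0|p xy]; first exact: ltr01.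
      by rewrite lt_min x0.
    by rewrite subr_gt0.
  exists (t / #|Z|.+1%:R); split; first by rewrite divr_gt0.
  move=> x z xz; apply: (@le_trans _ _ t).
    by rewrite -mulrA ler_piMr ?(ltW t0)// mulrC ler_pdivrMr// mul1r ler_nat.
  exact: (@bigmin_le_cond _ _ _ 1 (x, z) (fun p => u p.1 < u p.2) g xz).
pose rk z : K := (rank r' z)%:R.
have rkZ z : rk z <= #|Z|%:R by rewrite ler_nat max_card.
have rk0 z : 0 <= rk z by [].
(* The default for an empty maximum, low enough that [u'] stays below [u] there too. *)
pose b := - (\sum_z `|u z| + tau * #|Z|%:R).
have bu z : b <= u z - tau * rk z.
  rewrite /b opprD; apply: lerD; last by rewrite lerN2 ler_pM2l.
  rewrite lerNl; apply: (@le_trans _ _ `|u z|); first by rewrite -normrN ler_norm.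
  by rewrite (bigD1 z)//= lerDl sumr_ge0.
pose M z := \big[Num.max/b]_(x in A | r' z x) (u x - tau * rk x).
pose u' z := tau * rk z + M z.
have MM z z' : r' z z' -> M z' <= M z.
  move=> zz'; apply: bigmax_le => [|x /andP[xA z'x]]; first exact: bigmax_ge_id.
  by apply: (le_bigmax_cond b (fun x => u x - tau * rk x)); rewrite xA (tr z').
have uB z : z \in B -> u' z <= u z.
  move=> zB; rewrite /u' -lerBrDl; apply: bigmax_le => // x /andP[xA zx].
  have [ndx ndz] := nest x z xA zB.
  have uxz : u x <= u z by rewrite -ru; exact: ndz.
  (* A tie at [u] needs the ranks to be ordered, which the first half of [nested] gives; a strict
     inequality is settled by [gap]. *)
  have [xz|xz] := eqVneq (u x) (u z).
    have : r' x z by apply: ndx; rewrite ru xz.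
    rewrite rankP// xz lerD2l lerN2 ler_pM2l// ler_nat => ->//.
  have {}xz : u x < u z by rewrite lt_neqAle xz.
  have := gap _ _ xz; have : tau * rk z <= tau * #|Z|%:R by rewrite ler_pM2l.
  have : 0 <= tau * rk x by rewrite mulr_ge0// ltW.
  lra.
exists u'; split => //.
- move=> z z'; apply/idP/idP => [zz'|].
    by rewrite lerD// ?MM// ler_pM2l// ler_nat -rankP.
  apply: contraTT => nzz'; rewrite -ltNge.
  have z'z : r' z' z by have := tot z z'; rewrite (negbTE nzz').
  by rewrite ltr_leD ?MM// ltr_pM2l// ltr_nat ltnNge -rankP.
- move=> x xA; apply/eqP; rewrite eq_le uB/=; last exact: (fintype.subsetP AB).
  rewrite -lerBlDl; apply: (le_bigmax_cond b (fun x => u x - tau * rk x)).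
  by rewrite xA; have := tot x x; rewrite orbb.
Qed.

End Preorder.

(** * From rational implementation to the ordinal conditions *)

Section Necessity.
Variables (I : nat) (Z Theta : finType) (pref : Theta -> 'I_I -> rel Z).
Variable F : Theta -> {set Z}.

(* [D i th] stands for the outcomes that agent [i] can force with positive
   probability when the others play their parts of an equilibrium at [th]. *)
Definition blocking_sets (Zs : {set Z}) (D : 'I_I -> Theta -> {set Z}) : Prop :=
  [/\ forall i th, F th \subset D i th /\ D i th \subset Zs,
      forall i th, (forall x z, x \in F th -> z \in D i th -> pref th i z x) ->
        dominates (pref th i) (D i th) (D i th),
      forall th, (forall i, dominates (pref th i) Zs Zs) -> Zs \subset F th,
      forall i th th', (forall j, j != i -> dominates (pref th' j) (D i th) Zs) ->
        dominates (pref th' i) (D i th) (D i th) -> D i th \subset F th' &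
      forall th th', (forall i, dominates (pref th' i) (F th) (D i th) \/
        nested (pref th i) (pref th' i) (F th) (D i th)) -> F th \subset F th'].

Hypothesis hpref : forall th i, total (pref th i) /\ transitive (pref th i).
Hypothesis hF : forall th, exists x, x \in F th.

Lemma blocking_sets_exist : mixed_Nash_implementable_Q pref F ->
  exists Zs D, blocking_sets Zs D.
Proof.
move=> [G impl].
(* Reference equilibria at each state are taken for a single rational utility, the rank. *)
pose u0 th i z : rat := (rank (pref th i) z)%:R.
have u0P th : represents pref th (u0 th).
  by move=> i z z'; have [tot tr] := hpref th i; rewrite ler_nat -rankP.
pose uR th i z : R := ratr (u0 th i z).
have uRP th i z z' : pref th i z z' = (uR th i z' <= uR th i z).
  by rewrite /uR ler_rat u0P.
have suppF th lam z : MNE (uR th) lam -> (0 < @induced_lottery _ _ G lam z)%E -> z \in F th.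
  by move=> ml lz; apply/(impl th _ (u0P th)); exists lam.
pose Zs := [set z | `[< exists lam : mixed_profile G,
  is_mixed_profile lam /\ (0 < induced_lottery lam z)%E >]]%SET.
pose dev i (lam lam' : mixed_profile G) :=
  is_mixed_profile lam' /\ forall j, j != i -> lam' j = lam j.
pose D i th := [set z | `[< exists lam lam' : mixed_profile G,
  [/\ MNE (uR th) lam, dev i lam lam' & (0 < induced_lottery lam' z)%E] >]]%SET.
have suppZs (lam : mixed_profile G) z :
    is_mixed_profile lam -> (0 < induced_lottery lam z)%E -> z \in Zs.
  by move=> ml lz; rewrite finset.in_set; apply/asboolP; exists lam.
have suppD i th lam lam' z : MNE (uR th) lam -> dev i lam lam' ->
    (0 < induced_lottery lam' z)%E -> z \in D i th.
  by move=> ml dl lz; rewrite finset.in_set; apply/asboolP; exists lam, lam'.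
have FD i th : F th \subset D i th.
  apply/fintype.subsetP => z /(impl th _ (u0P th))[lam [ml lz]].
  by apply: suppD lz => //; split => //; case: ml.
exists Zs, D; split.
- move=> i th; split => //; apply/fintype.subsetP => z; rewrite finset.in_set => /asboolP.
  by move=> [lam [lam' [_ [ml' _] lz]]]; exact: (suppZs _ _ ml' lz).
(* The equilibrium yields at most the utility of [x]; a deviation never yields less, and would yield
   more if it reached an outcome above [x]. *)
- move=> i th Fmin.
  have [x xF] := hF th.
  have ge z : z \in D i th -> uR th i x <= uR th i z.
    by move=> zD; rewrite -uRP; exact: Fmin.
  suff le z : z \in D i th -> uR th i z <= uR th i x.
    by move=> z z' zD z'D; rewrite uRP (le_trans (le _ z'D))// ge.
  rewrite finset.in_set => /asboolP[lam [lam' [ml dl lz]]].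
  rewrite leNgt; apply/negP => lt.
  have : exp_util (uR th) lam' i <= exp_util (uR th) lam i.
    by case: ml dl => _ opt [ml' eq']; exact: opt.
  apply/negP; rewrite -ltNge; apply: (@le_lt_trans _ _ (uR th i x)).
    apply: exp_util_le; first by case: ml.
    move=> y ly; have yF := suppF _ _ _ ml ly.
    by rewrite -uRP; apply: Fmin => //; apply: (fintype.subsetP (FD i th)).
  apply: (exp_util_lt (z := z)) => //; first by case: dl.
  by move=> y ly; apply: ge; exact: (suppD _ _ _ _ _ ml dl ly).
(* With every agent indifferent over [Zs], any mixed profile is an equilibrium. *)
- move=> th ind; apply/fintype.subsetP => z; rewrite finset.in_set => /asboolP[lam [ml lz]].
  apply: (suppF _ lam) => //; split => // i lam' ml' _.
  apply: (@le_trans _ _ (uR th i z)).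
    apply: exp_util_le => // y ly; rewrite -uRP.
    exact: (ind _ _ _ (suppZs _ _ ml lz) (suppZs _ _ ml' ly)).
  apply: exp_util_ge => // y ly; rewrite -uRP.
  exact: (ind _ _ _ (suppZs _ _ ml ly) (suppZs _ _ ml lz)).
(* The profile [lam'] is an equilibrium at [th']: a further deviation by [i] is still one from
   [lam], hence stays in [D i th], and the others already get their best outcomes. *)
- move=> i th th' top ind; apply/fintype.subsetP => z zD.
  move: (zD); rewrite finset.in_set => /asboolP[lam [lam' [ml dl lz]]].
  apply: (suppF _ lam') => //; split => [|j lam'' ml'' eq'']; first by case: dl.
  apply: (@le_trans _ _ (uR th' j z)); last first.
    apply: exp_util_ge => [|y ly]; first by case: dl.
    have yD : y \in D i th by exact: (suppD _ _ _ _ _ ml dl ly).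
    rewrite -uRP; have [->|ji] := eqVneq j i; first exact: ind.
    apply: top => //; rewrite finset.in_set; apply/asboolP.
    by exists lam'; case: dl.
  apply: exp_util_le => // y ly; rewrite -uRP.
  have [ji|ji] := eqVneq j i.
    subst j; apply: ind => //; apply: (suppD _ _ lam lam'') => //; split => // k ki.
    by rewrite eq''//; apply dl.2.
  by apply: top => //; exact: (suppZs _ _ ml'' ly).
- move=> th th' cond.
  (* A utility at [th'] that keeps old equilibria stable: the rank if [F th] dominates, otherwise
     the one from [nested_utility]. *)
  have /choice[u' u'P] : forall i, exists u' : Z -> rat,
     (forall z z', pref th' i z z' = (u' z' <= u' z)) /\
     forall lam lam' : mixed_profile G, MNE (uR th) lam -> dev i lam lam' ->
       \sum_z fine (induced_lottery lam' z) * ratr (u' z) <=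
       \sum_z fine (induced_lottery lam z) * ratr (u' z).
    move=> i; have [tot tr] := hpref th' i.
    case: (cond i) => [top|nest].
      exists (u0 th' i); split; first exact: u0P.
      move=> lam lam' ml dl; have [x xF] := hF th.
      have [mp' _] := dl; have [mp _] := ml.
      apply: (@le_trans _ _ (uR th' i x)).
        apply: (exp_util_le (u := uR th')) => // y ly; rewrite -uRP.
        by apply: top => //; exact: (suppD _ _ _ _ _ ml dl ly).
      apply: (exp_util_ge (u := uR th')) => // y ly; rewrite -uRP.
      apply: top => //; first exact: (suppF _ _ _ ml ly).
      exact: (fintype.subsetP (FD i th)).
    have [v [vr vA vB]] := nested_utility tot tr (FD i th) nest (u0P th i).
    exists v; split => // lam lam' ml dl; have [mp' eq'] := dl; have [mp opt] := ml.
    (* On [D i th] the new utility is at most the old one, [lam] is optimal for the old one, and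
       both agree on [F th]. *)
    apply: le_trans (le_trans (opt i lam' mp' eq') _).
      apply: ler_sum => z _.
      have [lz|lz] := pselect (0 < induced_lottery lam' z)%E.
        rewrite ler_wpM2l ?fine_lottery_ge0// ler_rat; apply: vB.
        exact: (suppD _ _ _ _ _ ml dl lz).
      by rewrite fine_lottery_eq0// !mul0r.
    apply: ler_sum => z _.
    have [lz|lz] := pselect (0 < induced_lottery lam z)%E.
      by rewrite vA//; exact: (suppF _ _ _ ml lz).
    by rewrite fine_lottery_eq0// !mul0r.
  have rep' : represents pref th' u' by move=> i; exact: (u'P i).1.
  apply/fintype.subsetP => z /(impl th _ (u0P th))[lam [ml lz]].
  apply/(impl th' _ rep'); exists lam; split => //; split; first by case: ml.
  by move=> i lam' mp' eq'; apply: (u'P i).2.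
Qed.

End Necessity.

(** * Lotteries and menus *)

Section Lotteries.
Variables (K : realType) (Z : finType).
Implicit Types (y p q u : Z -> K) (A : {set Z}) (a e : K).

Definition lottery y := (forall z, 0 <= y z) /\ \sum_z y z = 1.

Definition mean y u := \sum_z y z * u z.

Definition uniform A z : K := (z \in A)%:R / #|A|%:R.

Definition dirac (w z : Z) : K := (z == w)%:R.

Definition mix e p q z := e * p z + (1 - e) * q z.

Lemma uniform_lottery A x : x \in A -> lottery (uniform A).
Proof.
move=> xA; have A0 : #|A|%:R != 0 :> K by rewrite pnatr_eq0 -lt0n; apply/card_gt0P; exists x.
split=> [z|]; first by rewrite divr_ge0.
rewrite -mulr_suml (_ : \sum_z _ = #|A|%:R) ?divff//.
by rewrite -sum1_card natr_sum [RHS]big_mkcond; apply: eq_bigr => z _; case: ifP.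
Qed.

Lemma uniform_gt0 A z : (0 < uniform A z) = (z \in A).
Proof.
apply/idP/idP => [|zA]; rewrite /uniform; first by case: (z \in A) => //=; rewrite mul0r ltxx.
by rewrite zA divr_gt0// ltr0n; apply/card_gt0P; exists z.
Qed.

Lemma dirac_lottery w : lottery (dirac w).
Proof.
split=> [z|]; first by rewrite /dirac.
by rewrite (bigD1 w)//= /dirac eqxx big1 ?addr0// => z /negbTE ->.
Qed.

Lemma mix_lottery e p q : 0 <= e <= 1 -> lottery p -> lottery q -> lottery (mix e p q).
Proof.
move=> /andP[e0 e1] [p0 p1] [q0 q1]; split=> [z|].
  by rewrite addr_ge0// mulr_ge0// subr_ge0.
by rewrite big_split/= -!mulr_sumr p1 q1 !mulr1 addrC subrK.
Qed.

Lemma mix_gt0 e p q z : 0 < e < 1 -> lottery p -> lottery q ->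
  (0 < mix e p q z) = (0 < p z) || (0 < q z).
Proof.
move=> /andP[e0 e1] [p0 _] [q0 _]; rewrite /mix.
have e1' : 0 < 1 - e by rewrite subr_gt0.
apply/idP/orP => [|[pz|qz]]; last 2 first.
- by rewrite ltr_wpDr ?mulr_gt0// mulr_ge0// ltW.
- by rewrite ltr_wpDl// ?mulr_gt0// mulr_ge0// ltW.
move=> pq; have [pz|pz] := ltP 0 (p z); first by left.
right; rewrite ltNge; apply: contraL pq => qz; rewrite -leNgt.
by rewrite -[leRHS]addr0 lerD// pmulr_rle0.
Qed.

Lemma mean_mix e p q u : mean (mix e p q) u = e * mean p u + (1 - e) * mean q u.
Proof.
rewrite /mean !mulr_sumr -big_split/=; apply: eq_bigr => z _.
by rewrite /mix mulrDl !mulrA.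
Qed.

Lemma mean_dirac w u : mean (dirac w) u = u w.
Proof.
rewrite /mean (bigD1 w)//= /dirac eqxx mul1r big1 ?addr0// => z /negbTE ->.
by rewrite mul0r.
Qed.

Lemma mean_le y u c : lottery y -> (forall z, 0 < y z -> u z <= c) -> mean y u <= c.
Proof.
move=> [y0 y1] uc; rewrite -[c]mul1r -y1 mulr_suml; apply: ler_sum => z _.
have := y0 z; rewrite le_eqVlt => /orP[/eqP <-|yz]; first by rewrite !mul0r.
by rewrite ler_wpM2l// uc.
Qed.

Lemma mean_ge0 y u : lottery y -> (forall z, 0 <= u z) -> 0 <= mean y u.
Proof. by move=> [y0 _] u0; apply: sumr_ge0 => z _; rewrite mulr_ge0. Qed.

Lemma mean_lt y u c z : lottery y -> (forall z, 0 < y z -> u z <= c) ->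
  0 < y z -> u z < c -> mean y u < c.
Proof.
move=> [y0 y1] uc yz uz; rewrite -[c]mul1r -y1 mulr_suml /mean.
rewrite (bigD1 z)//= [ltRHS](bigD1 z)//=; apply: ltr_leD; first by rewrite ltr_pM2l.
apply: ler_sum => x _.
have := y0 x; rewrite le_eqVlt => /orP[/eqP <-|yx]; first by rewrite !mul0r.
by rewrite ler_wpM2l// uc.
Qed.

Lemma maximizer A u x : x \in A -> exists2 w, w \in A & forall z, z \in A -> u z <= u w.
Proof.
by move=> xA; case: (@arg_maxP _ _ _ x (mem A) u xA) => w wA wmax; exists w.
Qed.

(** Half of the mass of [x] in the uniform lottery goes to [z], and weight [a] is transferred from
    the uniform lottery to [q]. The half left at [x] keeps this nonnegative for [a] up to 1/2. *)
Definition shift A x z a q t : K :=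
  uniform A t + (dirac z t - dirac x t) / (2 * #|A|%:R) + a * (q t - uniform A t).

(** Each summand is nonnegative when [0 <= a <= 2^-1], so positivity and support can be read off. *)
Lemma shift_decomp A x z a q t : x \in A -> shift A x z a q t =
  dirac z t / (2 * #|A|%:R) + a * q t +
  (if t == x then (2^-1 - a) * uniform A t else (1 - a) * uniform A t).
Proof.
move=> xA; have A0 : #|A|%:R != 0 :> K by rewrite pnatr_eq0 -lt0n; apply/card_gt0P; exists x.
rewrite /shift /dirac; case: (eqVneq t x) => [->|_] /=; last by rewrite subr0; ring.
rewrite /uniform xA mulr1n /=; move: (_ == z)%:R (#|A|%:R) A0 => d N N0.
by field; exact: N0.
Qed.

Lemma shift_lottery A x z a q : x \in A -> 0 <= a <= 2^-1 -> lottery q ->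
  lottery (shift A x z a q).
Proof.
move=> xA /andP[a0 a1] [q0 q1].
have [y0 y1] := uniform_lottery xA; split=> [t|].
  rewrite shift_decomp// !addr_ge0 ?mulr_ge0 ?q0 ?invr_ge0 ?mulr_ge0 /dirac//.
  by case: ifP => _; rewrite mulr_ge0// subr_ge0//; lra.
have [[_ d1] [_ d2]] := (dirac_lottery x, dirac_lottery z).
have E : \sum_t (dirac z t - dirac x t) / (2 * #|A|%:R) = 0.
  by rewrite -mulr_suml sumrB d1 d2 subrr mul0r.
rewrite !big_split/= E -mulr_sumr sumrB y1 q1.
by rewrite subrr mulr0 !addr0.
Qed.

Lemma shift_support A (H : {set Z}) x z a q t : x \in A -> A \subset H -> z \in H ->
  (forall t, 0 < q t -> t \in H) -> 0 <= a <= 2^-1 -> lottery q ->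
  0 < shift A x z a q t -> t \in H.
Proof.
move=> xA AH zH qH a01 [q0 q1]; apply: contraTT => tH.
have tA : t \notin A by apply: contra tH; apply: (fintype.subsetP AH).
have qt : q t = 0.
  by apply/eqP; rewrite eq_le q0 andbT leNgt; apply: contra tH; exact: qH.
rewrite shift_decomp// /uniform (negbTE tA) qt /dirac.
have /negbTE -> : t != z by apply: contraNneq tH => ->.
by rewrite !(mul0r, mulr0) if_same !add0r ltxx.
Qed.

Lemma shift_gt0 A x z a q t : x \in A -> 0 < a <= 2^-1 -> lottery q ->
  0 < q t -> 0 < shift A x z a q t.
Proof.
move=> xA /andP[a0 a1] [q0 q1] qt; rewrite shift_decomp//.
have [y0 y1] := uniform_lottery xA.
apply: ltr_wpDr; last apply: ltr_wpDl; last exact: mulr_gt0.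
  by case: ifP => _; rewrite mulr_ge0// subr_ge0//; lra.
by rewrite divr_ge0 ?mulr_ge0// /dirac.
Qed.

Lemma mean_shift A x z a q u : mean (shift A x z a q) u =
  mean (uniform A) u + (u z - u x) / (2 * #|A|%:R) + a * (mean q u - mean (uniform A) u).
Proof.
rewrite -(mean_dirac z) -(mean_dirac x) /mean /shift.
rewrite -!sumrB mulr_suml mulr_sumr -!big_split/=; apply: eq_bigr => t _; ring.
Qed.

(** Starting at 1/2 keeps the weights within the range allowed by [shift] and strictly below 1. *)
Definition harmonic n : K := n.+2%:R^-1.

Lemma harmonic_gt0 n : 0 < harmonic n.
Proof. by rewrite invr_gt0. Qed.

Lemma harmonic_le n : harmonic n <= 2^-1.
Proof. by rewrite lef_pV2 ?posrE// ler_nat. Qed.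

Lemma harmonic_lt1 n : harmonic n < 1.
Proof. by apply: le_lt_trans (harmonic_le n) _; lra. Qed.

Lemma harmonic_small c e : 0 < e -> exists n0, forall n, (n0 <= n)%N -> harmonic n * c <= e.
Proof.
move=> e0; exists (Num.bound (`|c| / e)) => n n0n.
rewrite mulrC ler_pdivrMr// mulrC -ler_pdivrMr//.
apply: (@le_trans _ _ (`|c| / e)); first by rewrite ler_pM2r ?invr_gt0// ler_norm.
apply: ltW; apply: (lt_le_trans (archi_boundP _)); first by rewrite divr_ge0// ltW.
by rewrite ler_nat (leq_trans n0n)// leqW.
Qed.

(* If some [x] in [A] is not [r]-minimal in [H], moving mass from [x] to a worse
   [z] pays for mixing in a small part of any lottery on [H]; otherwise [H] is a
   single indifference class and every lottery on [H] can be offered. *)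
Lemma menu_exists (r : rel Z) (A H : {set Z}) x0 :
  total r -> x0 \in A -> A \subset H ->
  ((forall x z, x \in A -> z \in H -> r z x) -> dominates r H H) ->
  exists (B : nat -> Z * Z * Z * bool -> Z -> K) (C : nat -> Z -> K),
  [/\ forall n d, lottery (B n d) /\ forall z, 0 < B n d z -> z \in H,
      forall n, lottery (C n) /\ forall z, 0 < C n z <-> z \in H,
      forall u, (forall z z', r z z' = (u z' <= u z)) -> exists n0, forall n, (n0 <= n)%N ->
        mean (C n) u <= mean (uniform A) u /\ forall d, mean (B n d) u <= mean (uniform A) u,
      forall r' u, (forall z z', r' z z' = (u z' <= u z)) ->
        ~ (dominates r' A H \/ nested r r' A H) ->
        exists d, forall n, mean (uniform A) u < mean (B n d) u &
      forall r' u, (forall z z', r' z z' = (u z' <= u z)) -> ~ dominates r' H H ->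
        exists d, forall n, mean (C n) u < mean (B n d) u].
Proof.
move=> tot x0A AH Hmin.
have x0H := fintype.subsetP AH _ x0A.
have yA := uniform_lottery x0A; have yH := uniform_lottery x0H.
have ltw A' r' u : A' \subset H -> (exists x, x \in A') ->
    (forall z z', r' z z' = (u z' <= u z)) -> ~ dominates r' A' H ->
    exists2 w, w \in H & mean (uniform A') u < u w.
  move=> A'H [x1 x1A] ru nd; have [w wH wmax] := maximizer u x0H; exists w => //.
  have [x [z [xA zH xz]]] : exists x z, [/\ x \in A', z \in H & u x < u z].
    apply: contra_notP nd => nex x z xA zH; rewrite ru leNgt; apply/negP => xz.
    by apply: nex; exists x, z.
  apply: (mean_lt (z := x)).
  - exact: uniform_lottery x1A.
  - by move=> t; rewrite uniform_gt0 => /(fintype.subsetP A'H); exact: wmax.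
  - by rewrite uniform_gt0.
  - by apply: (lt_le_trans xz); exact: wmax.
have [xz|] := pselect (exists x z, [/\ x \in A, z \in H & ~~ r z x]); last first.
  (* All of [H] is indifferent at [r], so the items may be arbitrary outcomes of [H]. *)
  move=> nxz; have ind : dominates r H H.
    apply: Hmin => x z xA zH; apply: contrapT => /negP nr; apply: nxz.
    by exists x, z.
  pose B (n : nat) (d : Z * Z * Z * bool) := if d.1.2 \in H then dirac d.1.2 else uniform A.
  exists B, (fun=> uniform H); split.
  - move=> n d; rewrite /B; case: ifP => dH; split => //.
    + exact: dirac_lottery.
    + by move=> z; rewrite /dirac ltr0n lt0b => /eqP ->.
    + by move=> z; rewrite uniform_gt0; exact: (fintype.subsetP AH).
  - by move=> n; split => // z; rewrite uniform_gt0.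
  - move=> u ru; exists 0%N => n _.
    have le z : z \in H -> u z <= mean (uniform A) u.
      move=> zH; rewrite -lerN2 /mean -sumrN.
      under eq_bigr do rewrite -mulrN.
      apply: (mean_le (u := fun z => - u z)) => // t; rewrite uniform_gt0 lerN2 => tA.
      by rewrite -ru; apply: ind => //; exact: (fintype.subsetP AH).
    split; first by apply: mean_le => // z; rewrite uniform_gt0; exact: le.
    by move=> d; rewrite /B; case: ifP => // dH; rewrite mean_dirac le.
  - move=> r' u ru nd; have [||||w wH lt] := ltw A r' u => //; first by exists x0.
      by move=> d; apply: nd; left.
    by exists (w, w, w, true) => n; rewrite /B /= wH mean_dirac.
  - move=> r' u ru nd; have [||||w wH lt] := ltw H r' u => //; first by exists x0.
    by exists (w, w, w, true) => n; rewrite /B /= wH mean_dirac.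
move: xz => [x1 [z1 [x1A z1H nr1]]].
(* An item moves mass from [x] to [z] and, when [b] holds, adds weight on [w]. That weight must be
   paid for by a strict loss at [r]; without it a weak loss is enough. *)
pose valid (d : Z * Z * Z * bool) := let: (x, z, w, b) := d in
  [&& x \in A, z \in H, w \in H & if b then ~~ r z x else r x z].
pose wt n (b : bool) : K := if b then harmonic n else 0.
pose B n d := if valid d then let: (x, z, w, b) := d in
  shift A x z (wt n b) (dirac w) else uniform A.
(* The items built on the same pair [x1], [z1] with [b] true differ from [C n] only by [dirac w] in
   place of the uniform lottery on [H]. *)
pose C n := shift A x1 z1 (harmonic n) (uniform H).
have wt01 n b : 0 <= wt n b <= 2^-1.
  by case: b => /=; rewrite ?harmonic_le ?(ltW (harmonic_gt0 _))//= ?lexx ?invr_ge0.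
have h01 n : 0 <= harmonic n <= 2^-1 by exact: (wt01 n true).
have N0 : 0 < 2 * #|A|%:R :> K.
  by rewrite mulr_gt0// ltr0n; apply/card_gt0P; exists x0.
(* The loss from [x] to [z] is fixed, while the weight on [q] tends to zero. *)
have small u x z q : (forall z z', r z z' = (u z' <= u z)) -> ~~ r z x ->
    exists n0, forall n, (n0 <= n)%N -> mean (shift A x z (harmonic n) q) u <= mean (uniform A) u.
  move=> ru; rewrite ru -ltNge => xz.
  have g0 : 0 < (u x - u z) / (2 * #|A|%:R) by rewrite divr_gt0// subr_gt0.
  have [n0 Hn0] := harmonic_small (mean q u - mean (uniform A) u) g0.
  exists n0 => n /Hn0; rewrite mean_shift -[u z - u x]opprB mulNr; lra.
exists B, C; split.
- move=> n [[[x z] w] b]; rewrite /B; case: ifP => [/and4P[xA zH wH _]|_]; split => //.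
  + by apply: shift_lottery => //; exact: dirac_lottery.
  + move=> t; apply: shift_support => //; last exact: dirac_lottery.
    by move=> s; rewrite /dirac ltr0n lt0b => /eqP ->.
  + by move=> t; rewrite uniform_gt0; exact: (fintype.subsetP AH).
- move=> n; split; first exact: shift_lottery.
  move=> z; split => [|zH].
    by apply: shift_support => // t; rewrite uniform_gt0.
  by apply: shift_gt0 => //; rewrite ?harmonic_gt0 ?harmonic_le// uniform_gt0.
- move=> u ru.
  have /choice[n0 Hn0] : forall d, exists n0, forall n, (n0 <= n)%N ->
      mean (B n d) u <= mean (uniform A) u.
    move=> d; case: (boolP (valid d)) => [|/negbTE nv]; last first.
      by exists 0%N => n _; rewrite /B nv.
    case: d => [[[x z] w] [|]] V; have /and4P[xA zH wH rxz] := V.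
      have [n0 Hn0] := small u x z (dirac w) ru rxz.
      by exists n0 => n /Hn0; rewrite /B V.
    exists 0%N => n _; rewrite /B V mean_shift mul0r addr0 gerDl.
    by rewrite pmulr_lle0 ?invr_gt0// subr_le0 -ru.
  have [n1 Hn1] := small u x1 z1 (uniform H) ru nr1.
  exists (maxn n1 (\max_d n0 d))%N => n; rewrite geq_max => /andP[n1n n0n]; split.
    exact: Hn1.
  by move=> d; apply: Hn0; apply: leq_trans n0n; exact: leq_bigmax.
- move=> r' u ru nd.
  have [||||w wH lt] := ltw A r' u => //; first by exists x0.
    by move=> d; apply: nd; left.
  (* When [nested] fails, either the move from [x] to [z] gains by itself, or it has stopped hurting
     and the weight on [w] gives the strict gain. *)
  have : exists x z, [/\ x \in A, z \in H & (r x z /\ u x < u z) \/ (u x <= u z /\ ~~ r z x)].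
    apply: contra_notP nd => nex; right => x z xA zH; split => rr.
      rewrite ru leNgt; apply/negP => xz; apply: nex; exists x, z; split => //.
      by left.
    apply: contrapT => /negP nr; apply: nex; exists x, z; split => //; right.
    by rewrite -ru.
  move=> [x [z [xA zH [[rxz xz]|[xz nr]]]]].
    exists (x, z, w, false) => n; rewrite /B /= xA zH wH rxz /=.
    by rewrite mean_shift mul0r addr0 ltrDl divr_gt0// subr_gt0.
  exists (x, z, w, true) => n; rewrite /B /= xA zH wH nr /=.
  rewrite mean_shift mean_dirac -addrA ltrDl ltr_wpDl//.
    by rewrite divr_ge0 ?(ltW N0)// subr_ge0.
  by rewrite mulr_gt0 ?harmonic_gt0// subr_gt0.
- move=> r' u ru nd; have [||||w wH lt] := ltw H r' u => //; first by exists x0.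
  exists (x1, z1, w, true) => n; rewrite /B /= x1A z1H wH nr1 /= /C.
  by rewrite !mean_shift mean_dirac ltrD2l ltr_pM2l ?harmonic_gt0// ltrD2r.
Qed.

End Lotteries.

(** * The canonical mechanism *)

Section Canonical.
Variables (I : nat) (Z Theta M : finType) (F : Theta -> {set Z}).
Variables (Zs : {set Z}) (D : 'I_I -> Theta -> {set Z}).
Variables (B : 'I_I -> Theta -> nat -> M -> Z -> R) (C : 'I_I -> Theta -> nat -> Z -> R).

(** A left message claims a state at an integer level. A right message dissents: it says how to
    challenge each possible consensus, which outcome is wanted as prize, and how much is bid. *)
Definition message : countType :=
  ((Theta * nat) + ({ffun Theta -> option (M * nat)} * Z * nat))%type.

Definition claim (x : message) : option Theta :=
  if x is inl (th, _) then Some th else None.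

Definition level (x : message) : nat := if x is inl (_, n) then n else 0%N.

Definition plan (x : message) : {ffun Theta -> option (M * nat)} :=
  if x is inr (phi, _, _) then phi else [ffun=> None].

(** The successor puts every dissent above a claim, which bids 0. *)
Definition bid (x : message) : nat := if x is inr (_, _, k) then k.+1 else 0%N.

(** A prize always has full support on [Zs]; a higher bid brings it closer to the wanted outcome,
    without an optimal bid in general. *)
Definition prize (x : message) : Z -> R :=
  if x is inr (_, t, k)
  then mix (harmonic _ k) (uniform _ Zs) (if t \in Zs then dirac _ t else uniform _ Zs)
  else uniform _ Zs.

Definition profile := {dffun forall i : 'I_I, (fun=> message) i}.
Implicit Types (m : profile) (i j : 'I_I) (th : Theta).

Definition consensus m i th := [forall j, (j != i) ==> (claim (m j) == Some th)].

(** Agent [i] is left out, so that nobody controls the menu that he faces himself. *)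
Definition others_level m i : nat := \max_(j | j != i) level (m j).

(** The component [C] spreads the outcome over all of [D i th]; its weight falls with [k], so a
    challenge approaches the item of [B]. *)
Definition challenge m i th : Z -> R :=
  if plan (m i) th is Some (d, k)
  then mix (harmonic _ k) (C i th (others_level m i)) (B i th (others_level m i) d)
  else uniform _ (F th).

Definition contest m : Z -> R :=
  if [pick i | [forall j, (j != i) ==> (bid (m j) < bid (m i))%N]] is Some i
  then prize (m i) else uniform _ Zs.

Definition canonical_outcome m : Z -> R :=
  if [pick p : 'I_I * Theta | consensus m p.1 p.2] is Some p
  then challenge m p.1 p.2 else contest m.

Hypothesis hI : (3 <= I)%N.
Hypothesis F0 : forall th, exists x, x \in F th.
Hypothesis Zs0 : exists x, x \in Zs.
Hypothesis FD : forall i th, F th \subset D i th.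
Hypothesis DZ : forall i th, D i th \subset Zs.
Hypothesis hB : forall i th n d,
  lottery (B i th n d) /\ forall z, 0 < B i th n d z -> z \in D i th.
Hypothesis hC : forall i th n,
  lottery (C i th n) /\ forall z, 0 < C i th n z <-> z \in D i th.

Lemma uniform_Zs : lottery (uniform R Zs).
Proof. by case: Zs0 => x; exact: uniform_lottery. Qed.

Lemma uniform_F th : lottery (uniform R (F th)).
Proof. by case: (F0 th) => x; exact: uniform_lottery. Qed.

Lemma harmonic01 k : 0 < harmonic R k < 1.
Proof. by rewrite harmonic_gt0 harmonic_lt1. Qed.

Lemma harmonic01W k : 0 <= harmonic R k <= 1.
Proof. by have /andP[/ltW -> /ltW ->] := harmonic01 k. Qed.

Lemma prizeP x : lottery (prize x) /\ forall z, 0 < prize x z <-> z \in Zs.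
Proof.
have HU := uniform_Zs; case: x => [[th n]|[[phi t] k]] /=.
  by split => // z; rewrite uniform_gt0.
have Ht : lottery (if t \in Zs then dirac R t else uniform R Zs).
  by case: ifP => // _; exact: dirac_lottery.
split=> [|z]; first by apply: mix_lottery => //; exact: harmonic01W.
rewrite mix_gt0 ?harmonic01// uniform_gt0; case: ifP => [tZ|_].
  by rewrite /dirac ltr0n lt0b; split => [/orP[//|/eqP -> //]|->].
by rewrite uniform_gt0 orbb.
Qed.

Lemma contestP m : lottery (contest m) /\ forall z, 0 < contest m z <-> z \in Zs.
Proof.
rewrite /contest; case: pickP => [i _|_]; first exact: prizeP.
by split=> [|z]; [exact: uniform_Zs|rewrite uniform_gt0].
Qed.

Lemma challengeP m i th :
  lottery (challenge m i th) /\ forall z, 0 < challenge m i th z -> z \in D i th.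
Proof.
rewrite /challenge; case: (plan (m i) th) => [[d k]|]; last first.
  split=> [|z]; [exact: uniform_F|rewrite uniform_gt0].
  exact: (fintype.subsetP (FD i th)).
have [lB sB] := hB i th (others_level m i) d.
have [lC sC] := hC i th (others_level m i).
split=> [|z]; first by apply: mix_lottery => //; exact: harmonic01W.
by rewrite mix_gt0 ?harmonic01// => /orP[/sC//|/sB].
Qed.

Lemma canonical_lottery m :
  (forall z, 0 <= canonical_outcome m z) /\ \sum_z canonical_outcome m z = 1.
Proof.
rewrite /canonical_outcome; case: pickP => [p _|_].
  exact: (challengeP m p.1 p.2).1.
exact: (contestP m).1.
Qed.

Lemma canonical_support m z : 0 < canonical_outcome m z -> z \in Zs.
Proof.
rewrite /canonical_outcome; case: pickP => [p _|_].
  by move=> /(challengeP m p.1 p.2).2; exact: (fintype.subsetP (DZ _ _)).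
by move/(contestP m).2.
Qed.

Lemma third i j : exists k, (k != i) && (k != j).
Proof.
apply/existsP; apply: contraLR hI; rewrite negb_exists => /forallP H.
rewrite -ltnNge -[X in (X < _)%N]card_ord ltnS.
apply: leq_trans (_ : #|[set i; j]%SET| <= 2)%N; last by rewrite cards2; case: (_ != _).
apply/subset_leq_card/fintype.subsetP => k _; have := H k.
by rewrite negb_and !negbK finset.in_set2.
Qed.

Lemma consensusP m i th j : consensus m i th -> j != i -> claim (m j) = Some th.
Proof. by move=> /forallP/(_ j)/implyP H /H /eqP. Qed.

(** Among three agents some [k] differs from both [i] and [j], and its claim counts for both. *)
Lemma consensus_uniq m i th j th' : consensus m i th -> consensus m j th' -> th = th'.
Proof.
move=> ci cj; have [k /andP[ki kj]] := third i j.
by have := consensusP cj kj; rewrite (consensusP ci ki) => -[].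
Qed.

Lemma claim_plan x th th' : claim x = Some th -> plan x th' = None.
Proof. by case: x => [[? ?]|[[? ?] ?]] //= _; rewrite ffunE. Qed.

(** The choice made by [pick] is immaterial: if two agents face a consensus, both make claims, so
    neither has a plan and both challenges are uniform on [F th]. *)
Lemma outcome_consensus m i th : consensus m i th ->
  canonical_outcome m = challenge m i th.
Proof.
move=> ci; rewrite /canonical_outcome; case: pickP => [[j th'] /= cj|/(_ (i, th))]; last first.
  by rewrite ci.
have tt' := consensus_uniq ci cj; subst th'.
have [<-//|ij] := eqVneq i j.
have pi : plan (m i) th = None by exact: claim_plan (consensusP cj ij).
have pj : plan (m j) th = None.
  by apply: claim_plan; apply: (consensusP ci); rewrite eq_sym.
by rewrite /challenge pi pj.
Qed.

Lemma outcome_contest m : (forall i th, ~~ consensus m i th) ->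
  canonical_outcome m = contest m.
Proof.
by move=> nc; rewrite /canonical_outcome; case: pickP => // p; rewrite (negbTE (nc _ _)).
Qed.

Lemma contest_winner m i : (forall j, j != i -> (bid (m j) < bid (m i))%N) ->
  contest m = prize (m i).
Proof.
move=> win; rewrite /contest; case: pickP => [j /forallP jwin|/(_ i)]; last first.
  by move=> /negP[]; apply/forallP => j; apply/implyP; exact: win.
have [->//|ji] := eqVneq j i.
by have := jwin i; rewrite eq_sym ji /= ltnNge (ltnW (win _ ji)).
Qed.

Definition canonical : mechanism I Z := Mechanism canonical_lottery.

Lemma consensus_upd m i th x :
  consensus (upd (T := fun=> message) m (i := i) x) i th = consensus m i th.
Proof. by apply: eq_forallb => j; case: eqVneq => //= ji; rewrite upd_out. Qed.

Lemma others_level_upd m i x :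
  others_level (upd (T := fun=> message) m (i := i) x) i = others_level m i.
Proof. by apply: eq_bigr => j ji; rewrite upd_out. Qed.

(** * Consequences of equilibrium in the canonical mechanism *)

Section Equilibrium.
Variables (u : 'I_I -> Z -> R) (lam : mixed_profile canonical).
Hypothesis u0 : forall i z, 0 <= u i z.
Hypothesis eqm : MNE u lam.

Let mixedP : is_mixed_profile lam. Proof. by case: eqm. Qed.

Lemma payoff_consensus m i th : consensus m i th ->
  payoff (G := canonical) u i m = mean (challenge m i th) (u i).
Proof. by move=> ci; rewrite /payoff /= (outcome_consensus ci). Qed.

(* Limit, as [k] tends to infinity, of the payoff of agent [i] when he replaces
   the message [a] by the bid [k] for [w], keeping the plan of [a] except that
   he challenges a consensus on [th0] by [d] when [od = Some (th0, d)]. *)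
Definition gain i (a : message) (w : Z) (od : option (Theta * M)) m : R :=
  if m i != a then payoff (G := canonical) u i m
  else if [pick th | consensus m i th] is Some th then
    if od is Some (th0, d) then
      if th == th0 then mean (B i th (others_level m i) d) (u i)
      else payoff (G := canonical) u i m
    else payoff (G := canonical) u i m
  else u i w.

Lemma gain_ge0 i a w od m : 0 <= gain i a w od m.
Proof.
have p0 : 0 <= payoff (G := canonical) u i m by exact: payoff_ge0.
rewrite /gain; case: ifP => // _; case: pickP => // th _.
case: od => [[th0 d]|] //; case: ifP => // _.
by apply: mean_ge0 => //; have [] := hB i th (others_level m i) d.
Qed.

(** Replacing [a] by [x k] is unprofitable for each [k], and the resulting payoffs are eventually at
    least [gain] up to any [e]; [esum_fatou] passes to the limit. *)
Lemma gain_le i a w od : w \in Zs ->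
  (\esum_(m in [set: profile]) (prob lam m * gain i a w od m)%:E <=
   \esum_(m in [set: profile]) (prob lam m * payoff (G := canonical) u i m)%:E)%E.
Proof.
move=> wZ.
pose newplan k : {ffun Theta -> option (M * nat)} :=
  [ffun th => if od is Some (th0, d) then if th == th0 then Some (d, k) else plan a th
              else plan a th].
pose x k : message := inr (newplan k, w, k).
pose t k : message -> message := fun y => if y == a then x k else y.
pose up m k : profile := @upd _ (msg canonical) m i (t k (m i)).
apply: (esum_fatou (v := fun k m => payoff (G := canonical) u i (up m k))).
- by move=> m; exact: prob_ge0.
- exact: (prob_mass mixedP).
- by move=> k m; exact: payoff_ge0.
- move=> m e e0; rewrite /gain; have [ma|nma] /= := eqVneq (m i) a; last first.
    exists 0%N => k _; rewrite /up /t (negbTE nma).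
    by rewrite (@upd_id _ (msg canonical)) gerDl oppr_le0 ltW.
  have upi k : up m k i = x k.
    by rewrite /up (@upd_in _ (msg canonical)) /t ma eqxx.
  have upj k j : j != i -> up m k j = m j by move=> ji; exact: upd_out.
  have upl k : others_level (up m k) i = others_level m i by exact: others_level_upd.
  have upc k th : consensus (up m k) i th = consensus m i th by exact: consensus_upd.
  case: pickP => [th ci|nc].
    have ci' k : consensus (up m k) i th by rewrite upc.
    have same : (forall k, newplan k th = plan a th) ->
        exists n0, forall n, (n0 <= n)%N ->
        payoff (G := canonical) u i m - e <= payoff (G := canonical) u i (up m n).
      move=> eqp; exists 0%N => k _; rewrite (payoff_consensus (ci' k)) (payoff_consensus ci).
      by rewrite /challenge upi upl ma /= eqp gerDl oppr_le0 ltW.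
    case: od @newplan @x @t @up upi upj upl upc ci' same
      => [[th0 d]|] newplan x t up upi upj upl upc ci' same; last by apply: same => k; rewrite ffunE.
    case: eqVneq => [thh|nth]; last by apply: same => k; rewrite ffunE (negbTE nth).
    have [n0 Hn0] := harmonic_small (mean (B i th (others_level m i) d) (u i)) e0.
    exists n0 => k /Hn0 small; rewrite (payoff_consensus (ci' k)) /challenge upi upl /=.
    rewrite ffunE -thh eqxx mean_mix.
    have C0 : 0 <= mean (C i th (others_level m i)) (u i).
      by apply: mean_ge0 => //; have [] := hC i th (others_level m i).
    have : 0 <= harmonic R k * mean (C i th (others_level m i)) (u i).
      by rewrite mulr_ge0// ltW// harmonic_gt0.
    lra.
  have [n0 Hn0] := harmonic_small (u i w) e0.
  (* The second term makes the bid [k.+1] exceed every other bid in [m]. *)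
  exists (maxn n0 (\max_j bid (m j))) => k; rewrite geq_max => /andP[/Hn0 small bids].
  have -> : payoff (G := canonical) u i (up m k) = mean (prize (x k)) (u i).
    rewrite /payoff /= outcome_contest; last first.
      (* Agent [i] now claims nothing, so no other agent faces a consensus. *)
      move=> j th; have [->|ji] := eqVneq j i; first by rewrite upc nc.
      apply/negP => cj; have := consensusP cj (_ : i != j).
      by rewrite upi eq_sym ji => /(_ isT).
    rewrite (contest_winner (i := i)); first by rewrite upi.
    move=> j ji; rewrite upi (upj k j ji) /= ltnS; apply: leq_trans bids.
    exact: (leq_bigmax (F := fun j => bid (m j))).
  rewrite /= wZ mean_mix mean_dirac.
  have : 0 <= harmonic R k * mean (uniform R Zs) (u i).
    by rewrite mulr_ge0 ?(ltW (harmonic_gt0 _ _))//; apply: mean_ge0 => //; exact: uniform_Zs.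
  lra.
- by move=> k; exact: (@MNE_deviation _ _ canonical u lam i (t k) eqm (u0 i)).
Qed.

Lemma payoff_le i w m : (forall z, z \in Zs -> u i z <= u i w) ->
  payoff (G := canonical) u i m <= u i w.
Proof.
move=> wmax; apply: mean_le; first exact: canonical_lottery.
by move=> z /canonical_support; exact: wmax.
Qed.

Lemma expected_payoff i : (\esum_(m in [set: profile])
  (prob lam m * payoff (G := canonical) u i m)%:E = (exp_util u lam i)%:E)%E.
Proof. exact: esym (exp_utilE mixedP (u0 i)). Qed.

Lemma finite_payoff i : (\esum_(m in [set: profile])
  (prob lam m * payoff (G := canonical) u i m)%:E < +oo)%E.
Proof. by rewrite expected_payoff ltry. Qed.

(* An agent who is not facing a consensus can win the contest, so he must already
   be getting his best outcomes. *)
Lemma support_no_consensus i m z : 0 < prob lam m -> (forall th, ~~ consensus m i th) ->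
  0 < canonical_outcome m z -> forall z', z' \in Zs -> u i z' <= u i z.
Proof.
move=> pm nc mz; have [x xZ] := Zs0; have [w wZ wmax] := maximizer (u i) xZ.
suff uz : u i z = u i w by move=> z' /wmax; rewrite uz.
(* Bidding for [w] lowers the payoff at no profile and cannot raise its expectation, so nothing
   changes at [m]. *)
have E : payoff (G := canonical) u i m = gain i (m i) w None m.
  apply: (esum_le_eq (p := prob lam) (f := payoff (G := canonical) u i)
    (g := gain i (m i) w None)) => //.
  - by move=> y; exact: prob_ge0.
  - by move=> y; exact: payoff_ge0.
  - move=> y; rewrite /gain; case: ifP => // _; case: pickP => // _.
    exact: payoff_le.
  - exact: finite_payoff.
  - exact: gain_le.
move: E; rewrite /gain eqxx /=; case: pickP => [th|_ E]; first by rewrite (negbTE (nc th)).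
apply/eqP; rewrite eq_le wmax ?(canonical_support mz)//= leNgt; apply/negP => lt.
have : payoff (G := canonical) u i m < u i w.
  apply: (mean_lt (z := z)) => //; first exact: canonical_lottery.
  by move=> y /canonical_support; exact: wmax.
by rewrite E ltxx.
Qed.

(** Challenging by [d] and bidding for [w] would lower the payoff at no profile and raise it at [m],
    which has positive probability. *)
Lemma no_profitable_challenge i m th d : 0 < prob lam m -> consensus m i th ->
  plan (m i) th = None -> ~ forall n, mean (uniform R (F th)) (u i) < mean (B i th n d) (u i).
Proof.
move=> pm ci pl prof; have [x xZ] := Zs0; have [w wZ wmax] := maximizer (u i) xZ.
have chE (y : profile) : y i = m i -> consensus y i th ->
    payoff (G := canonical) u i y < mean (B i th (others_level y i) d) (u i).
  by move=> yi cy; rewrite (payoff_consensus cy) /challenge yi pl.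
have E : payoff (G := canonical) u i m = gain i (m i) w (Some (th, d)) m.
  apply: (esum_le_eq (p := prob lam) (f := payoff (G := canonical) u i)
    (g := gain i (m i) w (Some (th, d)))) => //.
  - by move=> y; exact: prob_ge0.
  - by move=> y; exact: payoff_ge0.
  - move=> y; rewrite /gain; case: eqVneq => //= ymi; case: pickP => [th' cy|_].
      by case: eqVneq => // thth'; subst th'; apply: ltW; exact: chE.
    exact: payoff_le.
  - exact: finite_payoff.
  - exact: gain_le.
move: E; rewrite /gain eqxx /=; case: pickP => [th' ci'|/(_ th)]; last by rewrite ci.
rewrite -(consensus_uniq ci ci') eqxx => E.
by have := chE m erefl ci; rewrite E ltxx.
Qed.

Lemma esum_mix (e : R) i (g1 g2 : profile -> R) : 0 <= e <= 1 ->
  (forall m, 0 <= g1 m) -> (forall m, 0 <= g2 m) ->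
  (\esum_(m in [set: profile]) (prob lam m * g1 m)%:E <=
   \esum_(m in [set: profile]) (prob lam m * payoff (G := canonical) u i m)%:E)%E ->
  (\esum_(m in [set: profile]) (prob lam m * g2 m)%:E <=
   \esum_(m in [set: profile]) (prob lam m * payoff (G := canonical) u i m)%:E)%E ->
  (\esum_(m in [set: profile]) (prob lam m * (e * g1 m + (1 - e) * g2 m))%:E <=
   \esum_(m in [set: profile]) (prob lam m * payoff (G := canonical) u i m)%:E)%E.
Proof.
move=> /andP[e0 e1] g10 g20; rewrite expected_payoff => le1 le2.
have e1' : 0 <= 1 - e by rewrite subr_ge0.
have pg0 (g : profile -> R) : (forall m, 0 <= g m) -> forall m, (0 <= (prob lam m * g m)%:E)%E.
  by move=> g0 m; rewrite lee_fin mulr_ge0// prob_ge0.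
have -> : (\esum_(m in [set: profile]) (prob lam m * (e * g1 m + (1 - e) * g2 m))%:E =
   e%:E * (\esum_(m in [set: profile]) (prob lam m * g1 m)%:E) +
   (1 - e)%:E * (\esum_(m in [set: profile]) (prob lam m * g2 m)%:E))%E.
  rewrite -!esumZl//; try exact: pg0.
  rewrite -esumD => [|m _|m _]; try by rewrite mule_ge0 ?lee_fin// -lee_fin pg0.
  by apply: eq_esum => m _; rewrite -!EFinM -EFinD; congr EFin; ring.
apply: (@le_trans _ _ (e%:E * (exp_util u lam i)%:E + (1 - e)%:E * (exp_util u lam i)%:E)%E).
  by apply: leeD; apply: lee_wpmul2l; rewrite ?lee_fin.
by rewrite -!EFinM -EFinD lee_fin -mulrDl addrC subrK mul1r.
Qed.

(* Raising [k] in the current challenge and switching to [d] cannot both be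
   unprofitable when [d] improves on [C]. *)
Lemma no_better_challenge i m th d dk : 0 < prob lam m -> consensus m i th ->
  plan (m i) th = Some dk -> ~ forall n, mean (C i th n) (u i) < mean (B i th n d) (u i).
Proof.
case: dk => d0 k0 pm ci pl prof; have [x xZ] := Zs0; have [w wZ wmax] := maximizer (u i) xZ.
(* The two deviations are averaged with the weight [e] that [C] has in the current challenge, so
   that on a consensus on [th] the average replaces [C] by the better item [d]. *)
pose g1 := gain i (m i) w (Some (th, d)); pose g2 := gain i (m i) w (Some (th, d0)).
pose e := harmonic R k0.
have chE (y : profile) : y i = m i -> consensus y i th -> payoff (G := canonical) u i y <
    e * mean (B i th (others_level y i) d) (u i) +
    (1 - e) * mean (B i th (others_level y i) d0) (u i).
  move=> yi cy; rewrite (payoff_consensus cy) /challenge yi pl mean_mix ltrD2r.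
  by rewrite ltr_pM2l// harmonic_gt0.
have /andP[e0 e1] : 0 <= e <= 1 by exact: harmonic01W.
have E : payoff (G := canonical) u i m = e * g1 m + (1 - e) * g2 m.
  apply: (esum_le_eq (p := prob lam) (f := payoff (G := canonical) u i)
    (g := fun m => e * g1 m + (1 - e) * g2 m)) => //.
  - by move=> y; exact: prob_ge0.
  - by move=> y; exact: payoff_ge0.
  - move=> y; rewrite /g1 /g2 /gain; case: eqVneq => /= [ymi|_].
      case: pickP => [th' cy|_].
        case: eqVneq => [thth'|_]; first by subst th'; apply: ltW; exact: chE.
        by rewrite -mulrDl addrC subrK mul1r.
      by rewrite -mulrDl addrC subrK mul1r; exact: payoff_le.
    by rewrite -mulrDl addrC subrK mul1r.
  - exact: finite_payoff.
  - apply: esum_mix; rewrite ?e0 ?e1//; try exact: gain_ge0; exact: gain_le.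
move: E; rewrite /g1 /g2 /gain eqxx /=; case: pickP => [th' ci'|/(_ th)]; last by rewrite ci.
rewrite -(consensus_uniq ci ci') eqxx => E.
by have := chE m erefl ci; rewrite E ltxx.
Qed.

End Equilibrium.

(** * The canonical mechanism implements [F] *)

Variable pref : Theta -> 'I_I -> rel Z.
Hypothesis hblock : blocking_sets pref F Zs D.
Hypothesis unprofitable : forall i th u, (forall z z', pref th i z z' = (u z' <= u z)) ->
  exists n0, forall n, (n0 <= n)%N -> mean (C i th n) u <= mean (uniform R (F th)) u /\
    forall d, mean (B i th n d) u <= mean (uniform R (F th)) u.
Hypothesis profitable : forall i th r' u, (forall z z', r' z z' = (u z' <= u z)) ->
  ~ (dominates r' (F th) (D i th) \/ nested (pref th i) r' (F th) (D i th)) ->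
  exists d, forall n, mean (uniform R (F th)) u < mean (B i th n d) u.
Hypothesis improvable : forall i th r' u, (forall z z', r' z z' = (u z' <= u z)) ->
  ~ dominates r' (D i th) (D i th) ->
  exists d, forall n, mean (C i th n) u < mean (B i th n d) u.

(** A profile of positive probability has no consensus, a challenged one or an unchallenged one;
    these cases use the last three conditions of [blocking_sets] in turn. *)
Lemma canonical_sound th u (lam : mixed_profile canonical) z :
  (forall i z, 0 <= u i z) -> represents pref th u -> MNE u lam ->
  (0 < induced_lottery lam z)%E -> z \in F th.
Proof.
move=> u0 rep eqm lz; have [_ _ hall hstar hmon] := hblock.
have [mp _] := eqm; have [m pm mz] := lottery_gt0P mp lz.
have {}mz : 0 < canonical_outcome m z by [].
have top j x : (forall th', ~~ consensus m j th') -> 0 < canonical_outcome m x ->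
    forall z', z' \in Zs -> pref th j x z'.
  by move=> nc mx z' z'Z; rewrite rep; exact: (support_no_consensus u0 eqm pm nc mx).
have [[i [th0 ci]]|nc] := pselect (exists i th0, consensus m i th0); last first.
  have nc' j th' : ~~ consensus m j th' by apply/negP => cj; apply: nc; exists j, th'.
  have full x : x \in Zs -> 0 < canonical_outcome m x.
    by move=> xZ; rewrite outcome_contest//; apply/(contestP m).2.
  suff /fintype.subsetP : Zs \subset F th by apply; exact: (canonical_support mz).
  by apply: hall => j x z' xZ z'Z; apply: top => //; exact: full.
(* With a challenge in force, the support of the outcome is exactly [D i th0]. *)
case E : (plan (m i) th0) => [dk|].
  have full x : x \in D i th0 -> 0 < canonical_outcome m x.
    move=> xD; rewrite (outcome_consensus ci) /challenge E; case: dk {E} => d k.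
    have [lB _] := hB i th0 (others_level m i) d.
    have [lC sC] := hC i th0 (others_level m i).
    by rewrite mix_gt0 ?harmonic01//; apply/orP; left; apply/sC.
  have zD : z \in D i th0.
    by apply: (challengeP m i th0).2; rewrite -(outcome_consensus ci).
  suff /fintype.subsetP : D i th0 \subset F th by apply.
  apply: hstar => [j ji x z' xD z'Z|].
    apply: top => //; last exact: full.
    (* The challenger makes no claim, so [j] faces no consensus. *)
    move=> th'; apply/negP => cj.
    have := consensusP cj (_ : i != j); rewrite eq_sym ji => /(_ isT) cl.
    by rewrite (claim_plan _ cl) in E.
  apply: contrapT => /(improvable (rep i)) [d Hd].
  exact: (no_better_challenge u0 eqm pm ci E Hd).
suff /fintype.subsetP : F th0 \subset F th.
  by apply; move: mz; rewrite (outcome_consensus ci) /challenge E uniform_gt0.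
apply: hmon => j.
(* An agent facing the consensus has no profitable challenge; any other already gets his best
   outcomes. *)
have [[th' cj]|nc] := pselect (exists th', consensus m j th').
  have tt' := consensus_uniq ci cj; subst th'.
  have Ej : plan (m j) th0 = None.
    have [->//|ji] := eqVneq j i.
    by apply: claim_plan; exact: consensusP ci ji.
  apply: contrapT => /(profitable (rep j)) [d Hd].
  exact: (no_profitable_challenge u0 eqm pm cj Ej Hd).
left=> x z' xF z'D; apply: top.
- by move=> th'; apply/negP => cj; apply: nc; exists th'.
- by rewrite (outcome_consensus ci) /challenge E uniform_gt0.
- exact: (fintype.subsetP (DZ j th0)).
Qed.

(** All agents claim [th] at a level beyond every threshold. A lone deviator still faces a consensus
    at that level, where no menu item is profitable. *)
Lemma canonical_complete th u : (forall i z, 0 <= u i z) -> represents pref th u ->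
  exists lam : mixed_profile canonical, MNE u lam /\
    forall z, z \in F th -> (0 < induced_lottery lam z)%E.
Proof.
move=> u0 rep; have /choice[n0 Hn0] := fun i => unprofitable (rep i).
pose n := \max_i n0 i; pose a : message := inl (th, n).
pose lam : mixed_profile canonical := fun i x => (x == a)%:R.
have mp : is_mixed_profile lam.
  move=> i; split=> [x|]; first by rewrite /lam.
  rewrite (esumID [set a])//; last by move=> x _; rewrite lee_fin.
  rewrite setTI esum_set1 ?lee_fin// /lam eqxx esum1 ?adde0// => x [_ /= xa].
  by case: eqP.
pose m0 : profile := [ffun=> a].
have cons m i : (forall j, j != i -> m j = a) -> consensus m i th.
  by move=> ma; apply/forallP => j; apply/implyP => /ma ->.
have other i : exists j, j != i.
  by have [k /andP[ki _]] := third i i; exists k.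
have payoff_bound m i : (forall j, j != i -> m j = a) ->
    payoff (G := canonical) u i m <= mean (uniform R (F th)) (u i).
  move=> ma; rewrite (payoff_consensus _ (cons _ _ ma)) /challenge.
  have nl : (n0 i <= others_level m i)%N.
    have [j ji] := other i; apply: (@leq_trans n); first exact: leq_bigmax.
    apply: (@leq_trans (level (m j))); first by rewrite (ma _ ji).
    exact: (leq_bigmax_cond (F := fun j => level (m j))).
  have [leC leB] := Hn0 i _ nl.
  case: (plan _ _) => [[d k]|//]; rewrite mean_mix.
  apply: (@le_trans _ _ (harmonic R k * mean (uniform R (F th)) (u i) +
    (1 - harmonic R k) * mean (uniform R (F th)) (u i))); last first.
    by rewrite -mulrDl addrC subrK mul1r.
  by apply: lerD; rewrite ler_wpM2l// ?subr_ge0 ltW// ?harmonic_gt0 ?harmonic_lt1.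
have m0E i : payoff (G := canonical) u i m0 = mean (uniform R (F th)) (u i).
  have c0 : consensus m0 i th by apply: cons => j _; rewrite ffunE.
  by rewrite (payoff_consensus _ c0) /challenge ffunE /= ffunE.
have lam0 i x : lam i x != 0 -> x = a by rewrite /lam pnatr_eq0 eqb0 negbK => /eqP.
have prob_gt0 lam' (m : profile) i : 0 < prob (G := canonical) lam' m -> lam' i (m i) != 0.
  by rewrite /prob (bigD1 i)//=; apply: contraTneq => ->; rewrite mul0r ltxx.
have probm0 : 0 < prob lam m0.
  by rewrite /prob big1// => i _; rewrite /lam ffunE eqxx.
exists lam; split=> [|z zF]; last first.
  apply: (lottery_gt0 mp probm0).
  have j : 'I_I by exact: (Ordinal (ltnW (ltnW hI))).
  have c0 : consensus m0 j th by apply: cons => k _; rewrite ffunE.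
  by rewrite /= (outcome_consensus c0) /challenge ffunE /= ffunE uniform_gt0.
split=> // i lam' mp' eq'; apply: (@le_trans _ _ (mean (uniform R (F th)) (u i))).
  apply: exp_util_le_payoff => // m pm; apply: payoff_bound => j ji.
  by apply: (lam0 j); rewrite -eq'//; exact: prob_gt0 pm.
apply: exp_util_ge_payoff => [//|//||m pm].
  by apply: mean_ge0 => //; exact: uniform_F.
rewrite -m0E.
suff -> : m = m0 by [].
by apply/ffunP => j; rewrite ffunE; apply: (lam0 j); exact: prob_gt0 pm.
Qed.

Lemma canonical_implements th u : represents pref th u -> implements_at canonical u (F th).
Proof.
move=> rep; pose c := \sum_i \sum_z `|u i z|; pose v i z := u i z + c.
have v0 i z : 0 <= v i z.
  rewrite /v -lerBlDl sub0r; apply: (@le_trans _ _ `|u i z|).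
    by rewrite -normrN ler_norm.
  rewrite /c (bigD1 i)//= (bigD1 z)//= -addrA lerDl addr_ge0 ?sumr_ge0// => j _.
  by rewrite sumr_ge0.
have vrep : represents pref th v by move=> i z z'; rewrite rep lerD2r.
have vu : (fun i z => v i z + - c) = u.
  by apply/funext => i; apply/funext => z; rewrite /v addrK.
move=> z; split=> [zF|[lam [ml lz]]].
  have [lam [ml supp]] := canonical_complete v0 vrep.
  by exists lam; split; [rewrite -vu; exact: MNE_shift|exact: supp].
exact: (canonical_sound v0 vrep (MNE_shift c ml) lz).
Qed.

End Canonical.

(** * The two implications *)

Lemma implementable_Q_R (I : nat) (Z Theta : finType) (pref : Theta -> 'I_I -> rel Z)
  (F : Theta -> {set Z}) : (3 <= I)%N ->
  (forall th i, total (pref th i) /\ transitive (pref th i)) ->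
  (forall th, exists x, x \in F th) ->
  mixed_Nash_implementable_Q pref F -> mixed_Nash_implementable_R pref F.
Proof.
move=> hI hpref hF implQ.
(* Without states any mechanism works; a state is needed to make [Zs] nonempty. *)
have [th0|noth] := pselect (exists th : Theta, True); last first.
  by have [G _] := implQ; exists G => th; case: noth; exists th.
have [Zs [D block]] := blocking_sets_exist hpref hF implQ.
have [sub hmin _ _ _] := block.
have menu (p : 'I_I * Theta) := menu_exists R
  (hpref p.2 p.1).1 (projT2 (cid (hF p.2))) (sub p.1 p.2).1 (hmin p.1 p.2).
have /choice[B /choice[C BC]] := menu.
have i0 : 'I_I by exact: (Ordinal (ltnW (ltnW hI))).
have Zs0 : exists x, x \in Zs.
  have [th _] := th0; have [x xF] := hF th; exists x.
  by have [FD DZ] := sub i0 th; apply: (fintype.subsetP DZ); apply: (fintype.subsetP FD).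
have hB i th n d : lottery (B (i, th) n d) /\ forall z, 0 < B (i, th) n d z -> z \in D i th.
  by have [+ _ _ _ _] := BC (i, th); exact.
have hC i th n : lottery (C (i, th) n) /\ forall z, 0 < C (i, th) n z <-> z \in D i th.
  by have [_ + _ _ _] := BC (i, th); exact.
exists (canonical hF Zs0 (fun i th => (sub i th).1) hB hC) => th u rep.
apply: (canonical_implements hI hF Zs0 (fun i th => (sub i th).1)
  (fun i th => (sub i th).2) hB hC block) => // i th'.
- by have [_ _ + _ _] := BC (i, th').
- by have [_ _ _ + _] := BC (i, th').
- by have [_ _ _ _] := BC (i, th').
Qed.

Lemma implementable_R_Q (I : nat) (Z Theta : finType) (pref : Theta -> 'I_I -> rel Z)
  (F : Theta -> {set Z}) :
  mixed_Nash_implementable_R pref F -> mixed_Nash_implementable_Q pref F.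
Proof.
move=> [G impl]; exists G => th u rep; apply: impl => i z z'.
by rewrite ler_rat rep.
Qed.

End CanonicalMechanism.

Theorem theorem7 (I : nat) (hI : 3 <= I) (Z Theta : finType)
  (pref : Theta -> 'I_I -> rel Z)
  (hpref : forall th i, total (pref th i) /\ transitive (pref th i))
  (F : Theta -> {set Z}) (hF : forall th, F th != set0) :
  mixed_Nash_implementable_Q pref F <-> mixed_Nash_implementable_R pref F.
Proof.
split; last exact: CanonicalMechanism.implementable_R_Q.
by apply: CanonicalMechanism.implementable_Q_R => // th; apply/set0Pn.
Qed.
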